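(* Let $f,g$ be two non-proportional non-degenerate real ternary quadratic forms, with characteristic form $\Phi$, Hessian $H$ of $\Phi$, and autopolar triangle covariant $G$. (1) If $\mathrm{Disc}(\Phi)<0$ then $f,g$ generate a pencil in orbit I or Ia. (2) If $\mathrm{Disc}(\Phi)>0$ then $f,g$ generate a pencil in orbit Ib. (3) If $\mathrm{Disc}(\Phi)=0$ then $f,g$ generate a pencil in one of the six other orbits, and moreover: if $H\neq0$ and $G\neq0$ the orbit is II or IIa; if $H=0$ and $G\neq0$ the orbit is IV; if $H\neq0$ and $G=0$ the orbit is III or IIIa; if $H=0$ and $G=0$ the orbit is V. (Here $H=0$, $G=0$ mean vanishing identically as forms.)
   Context: Orbits. A pencil of conics is a projective line in $\mathbb{P}(S^2{\mathbb{R}^3}^* )$, non-degenerate if it contains the class of a non-degenerate form. There are nine orbits of non-degenerate pencils under $PGL(3,\mathbb{R})$, named I, Ia, Ib, II, IIa, III, IIIa, IV, V, with respective representatives the pencils generated by: I: $x^2-y^2,\ x^2-z^2$; Ia: $x^2+y^2+z^2,\ xz$; Ib: $x^2+y^2-z^2,\ xz$; II: $yz,\ x(y-z)$; IIa: $y^2+z^2,\ xz$; III: $xz,\ y^2$; IIIa: $x^2+y^2,\ z^2$; IV: $xz-y^2,\ xy$; V: $xz-y^2,\ x^2$. Characteristic form. $\mathrm{Disc}(f)$ is the determinant of the symmetric matrix of a ternary quadratic form $f$. $\Phi(t,u)=\mathrm{Disc}(tf+ug)=\Phi_{30}t^3+\Phi_{21}t^2u+\Phi_{12}tu^2+\Phi_{03}u^3$,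 and $\phi(t)=\Phi(t,1)$. The discriminant of $\Phi$ is normalized as $\mathrm{Disc}(\Phi)=\dfrac{\mathrm{Res}(\phi,\phi')}{27\,\Phi_{30}}$, with $\mathrm{Res}$ the usual resultant (determinant of the Sylvester matrix); thus $\mathrm{Disc}(\Phi)<0$ when $\phi$ has three distinct real roots. $H(t,u)=\det\begin{pmatrix}\partial^2\Phi/\partial t^2&\partial^2\Phi/\partial t\partial u\\ \partial^2\Phi/\partial t\partial u&\partial^2\Phi/\partial u^2\end{pmatrix}$. Autopolar triangle covariant $G$ (a cubic form in $x,y,z$, cubic in the coefficients of each of $f$ and $g$, defined up to a non-zero rational factor). For a quadratic form $q$ let $\tilde q$ be the quadratic form on the dual space whose matrix is the cofactor matrix of the matrix of $q$. For generic $f,g$ let $t_1,t_2,t_3$ be the complex roots of $\mathrm{Disc}(tf+g)$; then $\widetilde{t_if+g}=p_i^2$ for linear forms $p_i$ on the dual space, identified with points $p_i\in\mathbb{C}^3$, and with $p=(x,y,z)$, $G$ is $\dfrac{\det(p_1,p_2,p)\det(p_1,p_3,p)\det(p_2,p_3,p)}{(t_1-t_2)(t_1-t_3)(t_2-t_3)}$, which is a polynomial in the coefficients of $f,g$, thereby defined for all $f,g$. Explicitly: write $\widetilde{tf+g}=\tilde f t^2+\Omega t+\tilde g$, let $M$ be the $3\times6$ matrix whose rows are, for $\tilde f,\Omega,\tilde g$ in turn, the entries $(1,1),(2,2),(3,3),(2,3),(1,3),(1,2)$ of the corresponding symmetric matrix, label its columns $1,2,3,\bar1,\bar2,\bar3$,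 and let $[ijk]$ be the minor on columns $i,j,k$ in this order. Then $$\begin{aligned}G=&-[\bar1 2 3]x^3-[1\bar2 3]y^3-[1 2\bar3]z^3+([1\bar1 3]+2[\bar3\bar2 3])xy^2+([1 2\bar1]+2[\bar2 2\bar3])xz^2\\&+([\bar2 2 3]+2[\bar1\bar3 3])yx^2+([1 2\bar2]+2[1\bar1\bar3])yz^2+([\bar3 2 3]+2[\bar1 2\bar2])zx^2\\&+([1\bar3 3]+2[1\bar2\bar1])zy^2+(-[1 2 3]+4[\bar1\bar2\bar3])xyz.\end{aligned}$$ *)

(* Defs.v *)
From HB Require Import structures.
From mathcomp Require Import all_boot all_order all_algebra.
From mathcomp Require Import reals.
From mathcomp Require Import mpoly.

Set Implicit Arguments.
Unset Strict Implicit.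
Unset Printing Implicit Defensive.

Import Order.TTheory GRing.Theory Num.Theory.
Local Open Scope ring_scope.

Local Notation x := ('X_(@Ordinal 3 0 isT)).
Local Notation y := ('X_(@Ordinal 3 1 isT)).
Local Notation z := ('X_(@Ordinal 3 2 isT)).

(* A ternary quadratic form over a field F is some q : {mpoly F[3]} with
   q \is 2.-homog; binary forms live in {mpoly F[2]}. *)

(* The symmetric matrix A such that q = \sum_(i, j) A i j 'X_i 'X_j. *)
Definition qmx (F : fieldType) (q : {mpoly F[3]}) : 'M[F]_3 :=
  \matrix_(i, j) if i == j then q@_(U_(i) + U_(j))
                 else q@_(U_(i) + U_(j)) / 2.

Definition disc (F : fieldType) (q : {mpoly F[3]}) : F := \det (qmx q).

Definition proportional (F : fieldType) (f g : {mpoly F[3]}) : Prop :=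
  exists a b : F, (a, b) <> (0, 0) /\ a *: f = b *: g.

(* Pencils are represented by the corresponding linear subspaces of the space
   of forms. *)
Definition pencil (F : fieldType) (f g q : {mpoly F[3]}) : Prop :=
  exists a b : F, q = a *: f + b *: g.

(* q composed with the linear map v |-> P v. *)
Definition lin_subst (F : fieldType) (P : 'M[F]_3) (q : {mpoly F[3]}) :
    {mpoly F[3]} :=
  q \mPo [tuple \sum_j P i j *: 'X_j | i < 3].

Variant orbit_name :=
  OrbI | OrbIa | OrbIb | OrbII | OrbIIa | OrbIII | OrbIIIa | OrbIV | OrbV.

Definition orbit_rep (F : fieldType) (o : orbit_name) :
    {mpoly F[3]} * {mpoly F[3]} :=
  match o with
  | OrbI    => (x ^+ 2 - y ^+ 2, x ^+ 2 - z ^+ 2)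
  | OrbIa   => (x ^+ 2 + y ^+ 2 + z ^+ 2, x * z)
  | OrbIb   => (x ^+ 2 + y ^+ 2 - z ^+ 2, x * z)
  | OrbII   => (y * z, x * (y - z))
  | OrbIIa  => (y ^+ 2 + z ^+ 2, x * z)
  | OrbIII  => (x * z, y ^+ 2)
  | OrbIIIa => (x ^+ 2 + y ^+ 2, z ^+ 2)
  | OrbIV   => (x * z - y ^+ 2, x * y)
  | OrbV    => (x * z - y ^+ 2, x ^+ 2)
  end.

(* The pencil L is the image of the representative of o under an element of
   PGL_3, given by an invertible matrix; scalar matrices fix every pencil. *)
Definition pencil_in_orbit (F : fieldType) (o : orbit_name)
    (L : {mpoly F[3]} -> Prop) : Prop :=
  exists2 P : 'M[F]_3, P \in unitmx &
    forall q, L q <->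
      exists2 q0, pencil (orbit_rep F o).1 (orbit_rep F o).2 q0
                & q = lin_subst P q0.

(* The variables (t, u) of the characteristic form are 'X_0 and 'X_1. *)
Definition char_form (F : fieldType) (f g : {mpoly F[3]}) : {mpoly F[2]} :=
  \det ('X_0 *: map_mx (@mpolyC 2 F) (qmx f)
        + 'X_1 *: map_mx (@mpolyC 2 F) (qmx g)).

(* Phi(t, 1) *)
Definition dehomog (F : fieldType) (Phi : {mpoly F[2]}) : {poly F} :=
  mmap polyC (tnth [tuple 'X; 1]) Phi.

(* The Sylvester matrix of the library lists coefficients in increasing order
   of degree; for degrees m and n its determinant is (-1) ^ (m * n) times the
   one with decreasing order, hence equal to it in the case (3, 2) of interest
   here. *)
Definition disc_cubic (F : fieldType) (Phi : {mpoly F[2]}) : F :=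
  let phi := dehomog Phi in
  resultant phi phi^`() / (27 * Phi@_(U_(0) *+ 3)).

Definition hessian (F : fieldType) (Phi : {mpoly F[2]}) : {mpoly F[2]} :=
  \det (\matrix_(i < 2, j < 2) Phi^`M(i)^`M(j)).

Definition cofmx (A : comPzRingType) (n : nat) (B : 'M[A]_n) : 'M[A]_n :=
  \matrix_(i, j) cofactor B i j.

(* The coefficient of t in the cofactor matrix of t f + g. *)
Definition Omega (F : fieldType) (f g : {mpoly F[3]}) : 'M[F]_3 :=
  map_mx (coefp 1)
    (cofmx ('X *: map_mx polyC (qmx f) + map_mx polyC (qmx g))).

Local Notation o1 := (@Ordinal 3 0 isT).
Local Notation o2 := (@Ordinal 3 1 isT).
Local Notation o3 := (@Ordinal 3 2 isT).

Definition autopolar_mx (F : fieldType) (f g : {mpoly F[3]}) : 'M[F]_(3, 6) :=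
  \matrix_(r, c)
    let S := tnth [tuple cofmx (qmx f); Omega f g; cofmx (qmx g)] r in
    let ij := tnth [tuple (o1, o1); (o2, o2); (o3, o3);
                          (o2, o3); (o1, o3); (o1, o2)] c in
    S ij.1 ij.2.

(* The columns 1, 2, 3 are c1, c2, c3; the barred ones are b1, b2, b3. *)
Local Notation c1 := (@Ordinal 6 0 isT).
Local Notation c2 := (@Ordinal 6 1 isT).
Local Notation c3 := (@Ordinal 6 2 isT).
Local Notation b1 := (@Ordinal 6 3 isT).
Local Notation b2 := (@Ordinal 6 4 isT).
Local Notation b3 := (@Ordinal 6 5 isT).

(* For generic f, g, with t_1, t_2, t_3 the roots of disc (t f + g) and p_i
   the linear form on the dual space whose square has matrix
   cofmx (t_i f + g), this is
     det(p_1, p_2, p) det(p_1, p_3, p) det(p_2, p_3, p)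
       / ((t_1 - t_2) (t_1 - t_3) (t_2 - t_3)),       p = (x, y, z). *)
Definition autopolar (F : fieldType) (f g : {mpoly F[3]}) : {mpoly F[3]} :=
  let m i j k := \det (colsub (tnth [tuple i; j; k]) (autopolar_mx f g)) in
  - m b1 c2 c3 *: x ^+ 3
  - m c1 b2 c3 *: y ^+ 3
  - m c1 c2 b3 *: z ^+ 3
  + (m c1 b1 c3 + 2 * m b3 b2 c3) *: (x * y ^+ 2)
  + (m c1 c2 b1 + 2 * m b2 c2 b3) *: (x * z ^+ 2)
  + (m b2 c2 c3 + 2 * m b1 b3 c3) *: (y * x ^+ 2)
  + (m c1 c2 b2 + 2 * m c1 b1 b3) *: (y * z ^+ 2)
  + (m b3 c2 c3 + 2 * m b1 c2 b2) *: (z * x ^+ 2)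
  + (m c1 b3 c3 + 2 * m c1 b2 b1) *: (z * y ^+ 2)
  + (- m c1 c2 c3 + 4 * m b1 b2 b3) *: (x * y * z).

(* Main.v *)
Require Import Defs.
From HB Require Import structures.
From mathcomp Require Import all_boot all_order all_algebra.
From mathcomp Require Import reals ring.
From mathcomp Require Import polyrcf.
From mathcomp Require Import mpoly.
Import Order.TTheory GRing.Theory Num.Theory.
Local Open Scope ring_scope.

(** The proof has two independent halves.

    First, every pencil spanned by two non-proportional real conics, one of them
    nondegenerate, lies in one of the nine orbits ([classification]). A real
    cubic has a real root, so the pencil contains a singular conic: a double
    line, a pair of real lines or a pair of conjugate lines. Coordinates are
    chosen so that it is [x^2], [x z] or [x^2 + z^2], and a second generator is
    brought to normal form by the coordinate changes that preserve this conic and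
    by adding multiples of it. What remains is a list of explicit changes of
    coordinates and of generators.

    Secondly, the sign of the discriminant of the characteristic form, and the
    vanishing of its Hessian and of the autopolar triangle, are computed on each
    orbit ([sgr_disc_cubic], [hessian_eq0], [autopolar_eq0]). All three are
    covariant under a change of coordinates [P] and under a change of generators
    of the pencil, so it suffices to know them on the representatives. For the
    characteristic form this is the multiplicativity of determinants, together
    with the covariance of the discriminant and the Hessian of a binary cubic
    form. For the autopolar triangle, whose definition by minors hides the
    covariance, the key is the identity [autopolarE]: if [A] and [B] are the
    matrices of [f] and [g], then the value of the triangle at the vector [v] is

      det (A v | B v | B (cofmx A) B v).

    Both covariance properties can be read off this determinant, and so can the
    vanishing of the triangle when the pencil contains a double line.

    The discriminant of the characteristic form is negative on I and Ia, positive
    on Ib and zero on the other orbits. There the Hessian vanishes on IV and V,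
    where the characteristic form is a cube, and the triangle vanishes on III,
    IIIa and V, where the pencil contains a double line. The invariants of the
    given pencil therefore exclude all orbits but the announced ones. *)

Set Implicit Arguments.
Unset Strict Implicit.
Unset Printing Implicit Defensive.

(** * Explicit matrices of size 3 *)

Local Notation o1 := (@Ordinal 3 0 isT).
Local Notation o2 := (@Ordinal 3 1 isT).
Local Notation o3 := (@Ordinal 3 2 isT).

(** Sum-free products, cofactors and determinants of explicit matrices make
    every matrix identity below a list of ring or field identities. *)
Definition mx3 (A : Type) (a b c d e f g h i : A) : 'M[A]_3 :=
  \matrix_(r, s) tnth [tuple tnth [tuple a; b; c] s; tnth [tuple d; e; f] s;
                             tnth [tuple g; h; i] s] r.

(** The diagonal entries come first, then the entries (2,3), (1,3), (1,2), which
    is the order of the columns of [autopolar_mx]. *)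
Definition sym3 (A : Type) (a b c d e f : A) : 'M[A]_3 := mx3 a f e f b d e d c.

Lemma ord3P (P : 'I_3 -> Prop) : P o1 -> P o2 -> P o3 -> forall i, P i.
Proof.
by move=> P1 P2 P3 [[|[|[|//]]] lti]; rewrite (bool_irrelevance lti isT).
Qed.

Lemma mx3E (A : Type) (M : 'M[A]_3) :
  M = mx3 (M o1 o1) (M o1 o2) (M o1 o3) (M o2 o1) (M o2 o2) (M o2 o3)
          (M o3 o1) (M o3 o2) (M o3 o3).
Proof. by apply/matrixP; elim/ord3P; elim/ord3P; rewrite !mxE. Qed.

Lemma sym_mx3E (A : Type) (M : 'M[A]_3) : M^T = M ->
  M = sym3 (M o1 o1) (M o2 o2) (M o3 o3) (M o2 o3) (M o1 o3) (M o1 o2).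
Proof.
move=> Mt; have s i j : M i j = M j i by rewrite -{1}Mt mxE.
by rewrite {1}[M]mx3E (s o2 o1) (s o3 o1) (s o3 o2).
Qed.

Lemma sum3 (V : nmodType) (F : 'I_3 -> V) :
  \sum_i F i = F o1 + F o2 + F o3.
Proof.
rewrite !big_ord_recl big_ord0 addr0 addrA.
by congr (F _ + F _ + F _); apply: val_inj.
Qed.

Lemma det2 (A : comPzRingType) (M : 'M[A]_2) :
  \det M = M 0 0 * M 1 1 - M 0 1 * M 1 0.
Proof.
rewrite (expand_det_row _ 0) !big_ord_recl big_ord0 /cofactor !det_mx11 !mxE.
rewrite /= expr0 expr1 mul1r addr0 mulN1r mulrN.
by congr (M _ _ * M _ _ - M _ _ * M _ _); apply: val_inj.
Qed.

Section Mx3.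
Variable A : comPzRingType.
Implicit Types a b c d e f g h i : A.

Lemma mulmx3 a b c d e f g h i a' b' c' d' e' f' g' h' i' :
  mx3 a b c d e f g h i *m mx3 a' b' c' d' e' f' g' h' i' =
  mx3 (a * a' + b * d' + c * g') (a * b' + b * e' + c * h') (a * c' + b * f' + c * i')
      (d * a' + e * d' + f * g') (d * b' + e * e' + f * h') (d * c' + e * f' + f * i')
      (g * a' + h * d' + i * g') (g * b' + h * e' + i * h') (g * c' + h * f' + i * i').
Proof. by rewrite [LHS]mx3E !mxE !sum3 !mxE. Qed.

Lemma addmx3 a b c d e f g h i a' b' c' d' e' f' g' h' i' :
  mx3 a b c d e f g h i + mx3 a' b' c' d' e' f' g' h' i' =
  mx3 (a + a') (b + b') (c + c') (d + d') (e + e') (f + f') (g + g') (h + h') (i + i').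
Proof. by rewrite [LHS]mx3E !mxE. Qed.

Lemma scalemx3 k a b c d e f g h i :
  k *: mx3 a b c d e f g h i =
  mx3 (k * a) (k * b) (k * c) (k * d) (k * e) (k * f) (k * g) (k * h) (k * i).
Proof. by rewrite [LHS]mx3E !mxE. Qed.

Lemma trmx3 a b c d e f g h i :
  (mx3 a b c d e f g h i)^T = mx3 a d g b e h c f i.
Proof. by rewrite [LHS]mx3E !mxE. Qed.

Lemma detmx3 a b c d e f g h i :
  \det (mx3 a b c d e f g h i) =
  a * (e * i - f * h) - b * (d * i - f * g) + c * (d * h - e * g).
Proof.
rewrite (expand_det_row _ o1) sum3 /cofactor !det2 !mxE /=.
by rewrite /tnth /=; ring.
Qed.

Lemma cofmx3 a b c d e f g h i :
  cofmx (mx3 a b c d e f g h i) =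
  mx3 (e * i - f * h) (f * g - d * i) (d * h - e * g)
      (c * h - b * i) (a * i - c * g) (b * g - a * h)
      (b * f - c * e) (c * d - a * f) (a * e - b * d).
Proof.
rewrite [LHS]mx3E !mxE /cofactor !det2 !mxE /=.
by rewrite /tnth /=; congr mx3; ring.
Qed.

End Mx3.

Lemma map_mx3 (A B : Type) (phi : A -> B) a b c d e f g h i :
  map_mx phi (mx3 a b c d e f g h i) =
  mx3 (phi a) (phi b) (phi c) (phi d) (phi e) (phi f) (phi g) (phi h) (phi i).
Proof. by rewrite [LHS]mx3E !mxE. Qed.

(** * Quadratic forms and symmetric matrices *)

Local Notation x := ('X_o1).
Local Notation y := ('X_o2).
Local Notation z := ('X_o3).

Definition qform (F : fieldType) (A : 'M[F]_3) : {mpoly F[3]} :=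
  \sum_i \sum_j A i j *: ('X_i * 'X_j).

Lemma tr_qmx (F : fieldType) (q : {mpoly F[3]}) : (qmx q)^T = qmx q.
Proof. by apply/matrixP=> i j; rewrite !mxE eq_sym addmC. Qed.

(** A monomial of degree 2 is a square or a product of two distinct variables,
    and in the second case its coefficient is split evenly between two entries
    of the matrix. *)
Lemma qform_qmx (F : numFieldType) (q : {mpoly F[3]}) :
  q \is 2.-homog -> qform (qmx q) = q.
Proof.
move=> qhom; apply/mpolyP => m.
have mcf i j : ('X_i * 'X_j : {mpoly F[3]})@_m = (m == (U_(i) + U_(j))%MM)%:R.
  by rewrite -mpolyXD mcoeffX eq_sym.
have coefE : (qform (qmx q))@_m =
    \sum_i \sum_j qmx q i j * (m == (U_(i) + U_(j))%MM)%:R.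
  rewrite /qform raddf_sum /=; apply: eq_bigr => i _.
  rewrite raddf_sum /=; apply: eq_bigr => j _.
  by rewrite mcoeffZ mcf.
have [deg_m|deg_m] := eqVneq (mdeg m) 2%N; last first.
  rewrite coefE big1 ?(dhomog_nemf_coeff qhom) // => i _; rewrite big1 // => j _.
  case: eqP => [mE|_]; last by rewrite mulr0.
  by rewrite mE mdegD !mdeg1 eqxx in deg_m.
have mo (i j : 'I_3) : (m == (U_(i) + U_(j))%MM) =
   [&& m o1 == ((i == o1) + (j == o1))%N, m o2 == ((i == o2) + (j == o2))%N
     & m o3 == ((i == o3) + (j == o3))%N].
  apply/eqP/and3P=> [->|[/eqP m1 /eqP m2 /eqP m3]].
    by rewrite !mnmDE !mnm1E !eqxx.
  by apply/mnmP; elim/ord3P; rewrite mnmDE !mnm1E.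
rewrite coefE !sum3 !mo /=.
have : (m o1 + m o2 + m o3 = 2)%N.
  by rewrite -[RHS]deg_m mdegE; exact: esym (sum3 (fun i => m i)).
have qE i j : m = (U_(i) + U_(j))%MM -> q@_(U_(i) + U_(j)) = q@_m by move=> ->.
case E1: (m o1) => [|[|[|//]]]; case E2: (m o2) => [|[|[|//]]];
  case E3: (m o3) => [|[|[|//]]] // _; rewrite /= !(mulr0, addr0, add0r, mulr1) !mxE /=.
- by rewrite -(qE o3 o3) //; apply/eqP; rewrite mo E1 E2 E3.
- rewrite -(qE o2 o3); last by apply/eqP; rewrite mo E1 E2 E3.
  rewrite [(U_(o3) + _)%MM]addmC; by field.
- by rewrite -(qE o2 o2) //; apply/eqP; rewrite mo E1 E2 E3.
- rewrite -(qE o1 o3); last by apply/eqP; rewrite mo E1 E2 E3.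
  rewrite [(U_(o3) + _)%MM]addmC; by field.
- rewrite -(qE o1 o2); last by apply/eqP; rewrite mo E1 E2 E3.
  rewrite [(U_(o2) + _)%MM]addmC; by field.
- by rewrite -(qE o1 o1) //; apply/eqP; rewrite mo E1 E2 E3.
Qed.

(** Substituting [P v] for [v] in [v^T A v]. *)
Lemma lin_subst_qform (F : fieldType) (P A : 'M[F]_3) :
  lin_subst P (qform A) = qform (P^T *m A *m P).
Proof.
pose L i : {mpoly F[3]} := \sum_j P i j *: 'X_j.
have -> : lin_subst P (qform A) = \sum_i \sum_j A i j *: (L i * L j).
  rewrite /lin_subst /qform raddf_sum /=; apply: eq_bigr => i _.
  rewrite raddf_sum /=; apply: eq_bigr => j _.
  by rewrite comp_mpolyZ rmorphM /= !comp_mpolyXU -!tnth_nth !tnth_mktuple.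
rewrite /qform /L !sum3 !mxE !sum3 !mxE !sum3 !mxE -!mul_mpolyC; ring.
Qed.

Lemma qformD (F : fieldType) (A B : 'M[F]_3) : qform (A + B) = qform A + qform B.
Proof.
rewrite /qform -big_split; apply: eq_bigr => i _; rewrite -big_split.
by apply: eq_bigr => j _; rewrite mxE scalerDl.
Qed.

Lemma qformZ (F : fieldType) k (A : 'M[F]_3) : qform (k *: A) = k *: qform A.
Proof.
rewrite /qform scaler_sumr; apply: eq_bigr => i _; rewrite scaler_sumr.
by apply: eq_bigr => j _; rewrite mxE scalerA.
Qed.

Definition orbit_mx (F : fieldType) (o : orbit_name) : 'M[F]_3 * 'M[F]_3 :=
  match o with
  | OrbI    => (sym3 1 (-1) 0 0 0 0, sym3 1 0 (-1) 0 0 0)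
  | OrbIa   => (sym3 1 1 1 0 0 0, sym3 0 0 0 0 2^-1 0)
  | OrbIb   => (sym3 1 1 (-1) 0 0 0, sym3 0 0 0 0 2^-1 0)
  | OrbII   => (sym3 0 0 0 2^-1 0 0, sym3 0 0 0 0 (- 2^-1) 2^-1)
  | OrbIIa  => (sym3 0 1 1 0 0 0, sym3 0 0 0 0 2^-1 0)
  | OrbIII  => (sym3 0 0 0 0 2^-1 0, sym3 0 1 0 0 0 0)
  | OrbIIIa => (sym3 1 1 0 0 0 0, sym3 0 0 1 0 0 0)
  | OrbIV   => (sym3 0 (-1) 0 0 2^-1 0, sym3 0 0 0 0 0 2^-1)
  | OrbV    => (sym3 0 (-1) 0 0 2^-1 0, sym3 1 0 0 0 0 0)
  end.

Lemma qform_sym3 (F : fieldType) (a b c d e f : F) :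
  qform (sym3 a b c d e f) =
  a *: x ^+ 2 + b *: y ^+ 2 + c *: z ^+ 2
  + (d + d) *: (y * z) + (e + e) *: (x * z) + (f + f) *: (x * y).
Proof. rewrite /qform !sum3 !mxE /tnth /= -!mul_mpolyC; ring. Qed.

(** Allows the orbits of pencils to be handled on matrices only. *)
Lemma orbit_repE (F : numFieldType) o :
  orbit_rep F o = (qform (orbit_mx F o).1, qform (orbit_mx F o).2).
Proof.
have half : 2^-1 + 2^-1 = 1 :> F by field.
case: o; rewrite /orbit_mx !qform_sym3 /= -?opprD ?half; congr pair.
all: rewrite ?addr0 ?scale0r ?scaleNr ?scale1r.
all: by ring.
Qed.

(** * Pairs of symmetric matrices up to congruence and recombination *)

Definition congr_mx (A : comPzRingType) n (P M : 'M[A]_n) : 'M[A]_n :=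
  P^T *m M *m P.

Lemma congr_mxM (A : comPzRingType) n (P Q M : 'M[A]_n) :
  congr_mx P (congr_mx Q M) = congr_mx (Q *m P) M.
Proof. by rewrite /congr_mx trmx_mul !mulmxA. Qed.

Lemma congr_mx_lin (A : comPzRingType) n (P M N : 'M[A]_n) a b :
  congr_mx P (a *: M + b *: N) = a *: congr_mx P M + b *: congr_mx P N.
Proof. by rewrite /congr_mx mulmxDr mulmxDl -!scalemxAr -!scalemxAl. Qed.

Lemma map_congr_mx (A B : comPzRingType) (phi : {rmorphism A -> B}) n
    (P M : 'M[A]_n) :
  map_mx phi (congr_mx P M) = congr_mx (map_mx phi P) (map_mx phi M).
Proof. by rewrite /congr_mx !map_mxM map_trmx. Qed.

Lemma lincomb2 (A : pzRingType) (V : lmodType A) (u v : V) s t a b c d :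
  s *: (a *: u + b *: v) + t *: (c *: u + d *: v)
  = (s * a + t * c) *: u + (s * b + t * d) *: v.
Proof. by rewrite !scalerDr !scalerA addrACA -!scalerDl. Qed.

(** The pair itself is recorded, as two independent combinations of the
    representatives seen in other coordinates: the invariants below depend on the
    generators of the pencil and not only on the pencil. *)
Definition mx_orbit (F : fieldType) (o : orbit_name) (A B : 'M[F]_3) : Prop :=
  let: (M, N) := orbit_mx F o in
  exists (P : 'M[F]_3) (a b c d : F),
    [/\ P \in unitmx, a * d - b * c != 0,
        A = congr_mx P (a *: M + b *: N) & B = congr_mx P (c *: M + d *: N)].

Lemma pencil_in_orbit_mx (F : numFieldType) o (f g : {mpoly F[3]}) :
  f \is 2.-homog -> g \is 2.-homog -> mx_orbit o (qmx f) (qmx g) ->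
  pencil_in_orbit o (pencil f g).
Proof.
move=> fhom ghom; rewrite /mx_orbit /pencil_in_orbit orbit_repE.
case: (orbit_mx F o) => M N [P [a [b [c [d [Pu D fE gE]]]]]] /=.
have comb s t : s *: f + t *: g =
    lin_subst P (qform ((s * a + t * c) *: M + (s * b + t * d) *: N)).
  rewrite -(qform_qmx fhom) -(qform_qmx ghom) fE gE lin_subst_qform.
  by rewrite -!qformZ -qformD -congr_mx_lin lincomb2.
exists P => // q; split=> [[s [t ->]]|[q0 [s [t ->]] ->]].
  rewrite comb; eexists; last by [].
  by do 2!eexists; rewrite qformD !qformZ.
exists ((s * d - t * c) / (a * d - b * c)), ((t * a - s * b) / (a * d - b * c)).
rewrite comb -!qformZ -qformD.
by congr (lin_subst P (qform (_ *: M + _ *: N))); field.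
Qed.

(** Both the change of coordinates and the change of generators are invertible,
    so membership in an orbit can be pulled back along them. *)
Lemma mx_orbit_step (F : fieldType) o (P : 'M[F]_3) (a b c d : F)
    (A B A' B' : 'M[F]_3) :
  P \in unitmx -> a * d - b * c != 0 ->
  congr_mx P (a *: A + b *: B) = A' -> congr_mx P (c *: A + d *: B) = B' ->
  mx_orbit o A' B' -> mx_orbit o A B.
Proof.
move=> Pu D A'E B'E; rewrite /mx_orbit; case: (orbit_mx F o) => M N.
move=> [Q [k [l [m [n [Qu D' A'M B'M]]]]]].
have PK X : X = congr_mx (invmx P) (congr_mx P X).
  by rewrite congr_mxM mulmxV // /congr_mx trmx1 mul1mx mulmx1.
have back s t : s *: A + t *: B = congr_mx (Q *m invmx P)
   (((s * d - t * c) / (a * d - b * c) * k + (t * a - s * b) / (a * d - b * c) * m) *: M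
   + ((s * d - t * c) / (a * d - b * c) * l + (t * a - s * b) / (a * d - b * c) * n) *: N).
  rewrite -congr_mxM -lincomb2 [congr_mx Q _]congr_mx_lin -A'M -B'M -A'E -B'E.
  rewrite -congr_mx_lin lincomb2 -PK.
  by congr (_ *: A + _ *: B); field.
have := back 1 0; have := back 0 1; rewrite !scale0r !scale1r add0r addr0 => BE AE.
exists (Q *m invmx P); do 4!eexists; split; [| |exact: AE|exact: BE].
  by rewrite unitmx_mul Qu unitmx_inv.
set X := (X in X != 0); suff -> : X = (k * n - l * m) / (a * d - b * c).
  by rewrite mulf_neq0 ?invr_eq0.
by rewrite /X; field.
Qed.

(** * Classification of pairs of real symmetric matrices *)

Section Sym3.
Variable F : comPzRingType.
Implicit Types a b c d e f : F.

Lemma scale_sym3 k a b c d e f :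
  k *: sym3 a b c d e f = sym3 (k * a) (k * b) (k * c) (k * d) (k * e) (k * f).
Proof. exact: scalemx3. Qed.

Lemma add_sym3 a b c d e f a' b' c' d' e' f' :
  sym3 a b c d e f + sym3 a' b' c' d' e' f' =
  sym3 (a + a') (b + b') (c + c') (d + d') (e + e') (f + f').
Proof. exact: addmx3. Qed.

Lemma congr_sym3 a b c d e f p1 p2 p3 q1 q2 q3 r1 r2 r3 :
  let S u1 u2 u3 v1 v2 v3 := a * (u1 * v1) + b * (u2 * v2) + c * (u3 * v3)
    + d * (u2 * v3 + u3 * v2) + e * (u1 * v3 + u3 * v1) + f * (u1 * v2 + u2 * v1) in
  congr_mx (mx3 p1 q1 r1 p2 q2 r2 p3 q3 r3) (sym3 a b c d e f) =
  sym3 (S p1 p2 p3 p1 p2 p3) (S q1 q2 q3 q1 q2 q3) (S r1 r2 r3 r1 r2 r3)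
       (S q1 q2 q3 r1 r2 r3) (S p1 p2 p3 r1 r2 r3) (S p1 p2 p3 q1 q2 q3).
Proof. rewrite /congr_mx trmx3 !mulmx3 /=; congr mx3; ring. Qed.

Lemma det_sym3 a b c d e f :
  \det (sym3 a b c d e f) = a * b * c + 2 * d * e * f - a * d ^+ 2 - b * e ^+ 2 - c * f ^+ 2.
Proof. rewrite detmx3; ring. Qed.
End Sym3.

Section Classification.
Variable R : rcfType.
Implicit Types A B : 'M[R]_3.
Implicit Types a b c d e f k : R.

Definition classified A B := exists o, mx_orbit o A B.

Lemma mx_orbit_reps o : mx_orbit o (orbit_mx R o).1 (orbit_mx R o).2.
Proof.
rewrite /mx_orbit; case: (orbit_mx R o) => M N.
exists 1%:M, 1, 0, 0, 1; split; rewrite ?unitmx1 //.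
- by rewrite mulr0 subr0 mulr1 oner_neq0.
- by rewrite /congr_mx trmx1 mul1mx mulmx1 scale1r scale0r addr0.
- by rewrite /congr_mx trmx1 mul1mx mulmx1 scale1r scale0r add0r.
Qed.

Lemma mul1_neq0 (x y : R) : x * y = 1 -> x != 0.
Proof.
by move=> xy; apply/eqP=> x0; move: xy (oner_neq0 R) => <-; rewrite x0 mul0r eqxx.
Qed.

(** The inverses [i] and [j] of the two determinants are passed explicitly so
    that invertibility, too, is a field identity. *)
Lemma classified_rep o (P : 'M[R]_3) a b c d A B i j :
  \det P * i = 1 -> (a * d - b * c) * j = 1 ->
  congr_mx P (a *: A + b *: B) = (orbit_mx R o).1 ->
  congr_mx P (c *: A + d *: B) = (orbit_mx R o).2 -> classified A B.
Proof.
move=> /mul1_neq0; rewrite -unitfE -unitmxE => Pu /mul1_neq0 D AE BE; exists o.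
exact: mx_orbit_step Pu D AE BE (mx_orbit_reps o).
Qed.

Lemma classified_congr (P : 'M[R]_3) k A B A' B' i :
  \det P * i = 1 -> k != 0 -> congr_mx P A = A' -> k *: congr_mx P B = B' ->
  classified A' B' -> classified A B.
Proof.
move=> /mul1_neq0 P0 k0 AE BE [o oAB].
exists o; apply: (mx_orbit_step (P := P) (a := 1) (b := 0) (c := 0) (d := k)) oAB.
- by rewrite unitmxE unitfE.
- by rewrite mul1r mul0r subr0.
- by rewrite scale1r scale0r addr0.
- by rewrite scale0r add0r -BE /congr_mx -scalemxAr -scalemxAl.
Qed.

(** The determinant of [A] only serves to exclude degenerate shapes of [A], so it
    is enough to transport its nonvanishing, not its value. *)
Lemma classified_congr_nondeg (P : 'M[R]_3) k A B A' B' i :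
  \det P * i = 1 -> k != 0 -> congr_mx P A = A' -> k *: congr_mx P B = B' ->
  (\det A' != 0 -> classified A' B') -> \det A != 0 -> classified A B.
Proof.
move=> Pi k0 AE BE cl A0; apply: (classified_congr Pi k0 AE BE); apply: cl.
by rewrite -AE /congr_mx !det_mulmx det_tr !mulf_neq0 ?(mul1_neq0 Pi).
Qed.

Lemma pos_sqr k : 0 < k -> exists2 s : R, s != 0 & k = s ^+ 2.
Proof.
move=> k0; exists (Num.sqrt k); last by rewrite sqr_sqrtr ?ltW.
by rewrite sqrtr_eq0 -ltNge.
Qed.

Lemma neg_sqr k : k < 0 -> exists2 s : R, s != 0 & k = - s ^+ 2.
Proof.
rewrite -oppr_gt0 => /pos_sqr[s s0 kE]; exists s => //.
by rewrite -kE opprK.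
Qed.

Ltac sym3_field := rewrite ?detmx3 ?(scale_sym3, add_sym3, congr_sym3) /=;
  first [ exact: oner_neq0
        | (congr sym3; field; repeat (apply/andP; split); try done)
        | (field; repeat (apply/andP; split); try done) ].

(** Modulo [x^2] the first form is [b y^2 + c z^2]: the two signs give a pair of
    real lines or a pair of conjugate lines. *)
Lemma classified_diag_rank1 a b c : b != 0 -> c != 0 ->
  classified (sym3 a b c 0 0 0) (sym3 1 0 0 0 0 0).
Proof.
move=> b0 c0.
have [cb|cb|cb] := ltgtP (c / b) 0.
- have [s s0 cE] := neg_sqr cb; have -> : c = - s ^+ 2 * b; first by rewrite -cE divfK.
  apply: (@classified_rep OrbIII (mx3 0 1 0 2^-1 0 2^-1 (s^-1 / 2) 0 (- (s^-1 / 2)))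
    b^-1 (- a / b) 0 1 _ _ (2 * s) b); sym3_field.
- have [s s0 cE] := pos_sqr cb; have -> : c = s ^+ 2 * b; first by rewrite -cE divfK.
  apply: (@classified_rep OrbIIIa (mx3 0 0 1 1 0 0 0 s^-1 0)
    b^-1 (- a / b) 0 1 _ _ s b); sym3_field.
- by move/eqP: cb; rewrite mulf_eq0 invr_eq0 (negPf b0) (negPf c0).
Qed.

(** Modulo [x^2] the first form is [b y^2 + 2 x (e z + f y)]: a smooth conic
    tangent to the line [x = 0]. *)
Lemma classified_V a b e f : b != 0 -> e != 0 ->
  classified (sym3 a b 0 0 e f) (sym3 1 0 0 0 0 0).
Proof.
move=> b0 e0.
apply: (@classified_rep OrbV (mx3 1 0 0 0 1 0 0 (- f / e) (- b / (2 * e)))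
   (- b^-1) (a / b) 0 1 _ _ (- (2 * e / b)) (- b)); sym3_field.
Qed.

(** The singular form is [x^2]. The restriction of the other form to the line
    [x = 0] is nonzero by nondegeneracy; it is either nondegenerate, and then
    diagonalized, or a multiple of a square. *)
Lemma classified_rank1 a b c d e f :
  \det (sym3 a b c d e f) != 0 ->
  classified (sym3 a b c d e f) (sym3 1 0 0 0 0 0).
Proof.
wlog b0 : b c d e f / b != 0 => [wlog_b|].
  have [b0|] := eqVneq b 0; last exact: wlog_b.
  have [c0|c0] := eqVneq c 0; last first.
    apply: (@classified_congr_nondeg (mx3 1 0 0 0 0 1 0 1 0) 1 _ _
      (sym3 a c b d f e) (sym3 1 0 0 0 0 0) (-1)); try sym3_field.
    exact: wlog_b.
  have [d0|d0] := eqVneq d 0.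
    by rewrite det_sym3 b0 c0 d0 !(mulr0, mul0r, expr0n, subr0, addr0) eqxx.
  apply: (@classified_congr_nondeg (mx3 1 0 0 0 1 0 0 1 1) 1 _ _
      (sym3 a (b + c + 2 * d) c (c + d) e (e + f)) (sym3 1 0 0 0 0 0) 1); try sym3_field.
  by apply: wlog_b; rewrite b0 c0 !add0r mulf_neq0 ?pnatr_eq0.
wlog [-> ->] : a c d e f / d = 0 /\ f = 0 => [wlog_df|].
  apply: (@classified_congr_nondeg (mx3 1 0 0 (- f / b) 1 (- d / b) 0 0 1) 1 _ _
    (sym3 (a - f ^+ 2 / b) b (c - d ^+ 2 / b) 0 (e - d * f / b) 0)
    (sym3 1 0 0 0 0 0) 1); try sym3_field.
  exact: wlog_df.
have [->|c0] := eqVneq c 0.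
  have [->|e0 _] := eqVneq e 0.
    by rewrite det_sym3 !(mulr0, mul0r, expr0n, subr0, addr0) eqxx.
  exact: classified_V.
apply: (@classified_congr_nondeg (mx3 1 0 0 0 1 0 (- e / c) 0 1) 1 _ _
  (sym3 (a - e ^+ 2 / c) b c 0 0 0) (sym3 1 0 0 0 0 0) 1); try sym3_field.
by move=> _; apply: classified_diag_rank1.
Qed.

(** Only the line spanned by [B] matters once [B] is in normal form: [A] may be
    rescaled and corrected by any multiple of [B]. *)
Lemma classified_comb k l A B :
  k != 0 -> classified (k *: A + l *: B) B -> classified A B.
Proof.
move=> k0 [o oAB]; exists o.
apply: (mx_orbit_step (P := 1%:M) (a := k) (b := l) (c := 0) (d := 1)) oAB.
- exact: unitmx1.
- by rewrite mulr1 mulr0 subr0.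
- by rewrite /congr_mx trmx1 mul1mx mulmx1.
- by rewrite /congr_mx trmx1 mul1mx mulmx1 scale0r scale1r add0r.
Qed.

(** Modulo [x^2 + z^2] the first form is divisible by [z]; the other factor
    is taken as a new coordinate. *)
Lemma classified_IIa_def a c d e : d != 0 ->
  classified (sym3 a 0 c d e 0) (sym3 1 0 1 0 0 0).
Proof.
move=> d0; apply: (@classified_rep OrbIIa
  (mx3 0 1 0 (2 * d)^-1 (- e / d) (- (c - a) / (2 * d)) 0 0 1) 0 1 1 (- a) _ _
  (- (2 * d)) (-1)); sym3_field.
Qed.

(** Modulo [x^2 + z^2] and up to scaling, the first form is [y^2 + m z^2]. The
    pencils of [y^2 + m z^2] and [x^2 + z^2] are spanned, for [m] nonzero, by two
    forms [l1^2 + l3^2] and [l2^2 + l3^2], where [l3] is [z] if [m > 0] and [x] if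
    [m < 0]; with [l1 = X + Z], [l2 = X - Z] and [l3 = Y] their half-sum is
    [X^2 + Y^2 + Z^2] and their difference [4 X Z]. *)
Lemma classified_diag_def a b c : b != 0 ->
  classified (sym3 a b c 0 0 0) (sym3 1 0 1 0 0 0).
Proof.
move=> b0; have [m cE] : exists m, c = a + m * b.
  by exists ((c - a) / b); rewrite divfK // [RHS]addrC subrK.
have [m0|m0|m0] := ltgtP m 0.
- have [t t0 mE] := neg_sqr m0; rewrite {}cE {}mE.
  apply: (@classified_rep OrbIa (mx3 0 1 0 t 0 (- t) 1 0 1)
    (2 * t ^+ 2 * b)^-1 (1 - a / (2 * t ^+ 2 * b))
    (- (4 * t ^+ 2 * b)^-1) (a / (4 * t ^+ 2 * b))
    _ _ (- (2 * t)^-1) (4 * t ^+ 2 * b)); sym3_field.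
- have [t t0 mE] := pos_sqr m0; rewrite {}cE {}mE.
  apply: (@classified_rep OrbIa (mx3 1 0 1 t 0 (- t) 0 1 0)
    (2 * t ^+ 2 * b)^-1 (2^-1 - a / (2 * t ^+ 2 * b))
    (- (4 * t ^+ 2 * b)^-1) (4^-1 + a / (4 * t ^+ 2 * b))
    _ _ (2 * t)^-1 (4 * t ^+ 2 * b)); sym3_field.
- rewrite {}cE m0; apply: (@classified_rep OrbIIIa (mx3 1 0 0 0 0 1 0 1 0)
    0 1 b^-1 (- a / b) _ _ (-1) (- b)); sym3_field.
Qed.

Lemma sum_sqr_neq0 a b : a != 0 -> a ^+ 2 + b ^+ 2 != 0.
Proof.
move=> a0; rewrite paddr_eq0 ?sqr_ge0 //.
by rewrite negb_and sqrf_eq0 a0.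
Qed.

(** The singular form is [x^2 + z^2], whose vertex is the point [(0, 1, 0)]. If the
    other form vanishes there, the polar line of the vertex is a line through it,
    which a similarity of the [(x, z)]-plane brings to [z = 0]. Otherwise that
    polar line misses the vertex, becomes [y = 0], and the two forms restricted to
    it are diagonalized simultaneously. *)
Lemma classified_def a b c d e f :
  \det (sym3 a b c d e f) != 0 ->
  classified (sym3 a b c d e f) (sym3 1 0 1 0 0 0).
Proof.
have [->|b0] := eqVneq b 0.
  have [n0|n0] := eqVneq (d ^+ 2 + f ^+ 2) 0.
    have /andP[/eqP-> /eqP->] : (d == 0) && (f == 0).
      by rewrite -(sqrf_eq0 d) -(sqrf_eq0 f) -paddr_eq0 ?sqr_ge0 // n0.
    by rewrite det_sym3 !(mulr0, mul0r, expr0n, subr0, addr0) eqxx.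
  apply: (@classified_congr_nondeg (mx3 d 0 f 0 1 0 (- f) 0 d) (d ^+ 2 + f ^+ 2)^-1 _ _
    (sym3 (a * d ^+ 2 + c * f ^+ 2 - 2 * e * d * f) 0
          (a * f ^+ 2 + c * d ^+ 2 + 2 * e * d * f) (d ^+ 2 + f ^+ 2)
          (a * d * f - c * d * f + e * (d ^+ 2 - f ^+ 2)) 0)
    (sym3 1 0 1 0 0 0) (d ^+ 2 + f ^+ 2)^-1); try sym3_field.
    by rewrite invr_eq0.
  by move=> _; apply: classified_IIa_def.
apply: (@classified_congr_nondeg (mx3 1 0 0 (- f / b) 1 (- d / b) 0 0 1) 1 _ _
    (sym3 (a - f ^+ 2 / b) b (c - d ^+ 2 / b) 0 (e - d * f / b) 0)
    (sym3 1 0 1 0 0 0) 1); try sym3_field.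
move: (a - _) (c - _) (e - _) => {}a {}c {d f} {}e.
have [-> _|e0] := eqVneq e 0; first exact: classified_diag_def.
(* The vectors (e, s) and (- s, e) are the principal axes of the binary form
   a x^2 + 2 e x z + c z^2. *)
have [s sE] : exists s : R, s ^+ 2 = s * (c - a) + e ^+ 2.
  pose r := Num.sqrt ((c - a) ^+ 2 + 4 * e ^+ 2).
  have rE : r ^+ 2 = (c - a) ^+ 2 + 4 * e ^+ 2.
    by rewrite sqr_sqrtr // addr_ge0 ?sqr_ge0 // mulr_ge0 ?sqr_ge0.
  exists ((c - a + r) / 2); apply/eqP; rewrite -subr_eq0.
  have -> : ((c - a + r) / 2) ^+ 2 - ((c - a + r) / 2 * (c - a) + e ^+ 2) =
    (r ^+ 2 - ((c - a) ^+ 2 + 4 * e ^+ 2)) / 4 by field.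
  by rewrite rE subrr mul0r.
have n0 := sum_sqr_neq0 s e0.
apply: (@classified_congr_nondeg (mx3 e 0 (- s) 0 1 0 s 0 e) (e ^+ 2 + s ^+ 2)^-1 _ _
    (sym3 (a * e ^+ 2 + c * s ^+ 2 + 2 * e ^+ 2 * s) b
          (a * s ^+ 2 + c * e ^+ 2 - 2 * e ^+ 2 * s) 0
          (e * (s * (c - a) + e ^+ 2 - s ^+ 2)) 0)
    (sym3 1 0 1 0 0 0) (e ^+ 2 + s ^+ 2)^-1); try sym3_field.
  by rewrite invr_eq0.
by move=> _; rewrite {3}sE subrr mulr0; apply: classified_diag_def.
Qed.

(** Modulo [x z] the first form is [(y + r x + s z) (2 f x + 2 d z)] with
    [r = a / (2 f)] and [s = c / (2 d)]; the coordinates are [Y = 2 f x],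
    [Z = - 2 d z] and [X = y + r x + s z]. *)
Lemma classified_II_indef a c d e f : d != 0 -> f != 0 ->
  classified (sym3 a 0 c d e f) (sym3 0 0 0 0 2^-1 0).
Proof.
move=> d0 f0; apply: (@classified_rep OrbII
  (mx3 0 (2 * f)^-1 0 1 (- a / (4 * f ^+ 2)) (c / (4 * d ^+ 2)) 0 0 (- (2 * d)^-1))
  0 (- (4 * d * f)) 1 (- (2 * e - d * a / f - f * c / d)) _ _
  (4 * d * f) (4 * d * f)^-1); sym3_field.
Qed.

(** Modulo [x z] the first form is [c z^2 + x (2 f y + a x)]. *)
Lemma classified_IV_indef a c e f : c != 0 -> f != 0 ->
  classified (sym3 a 0 c 0 e f) (sym3 0 0 0 0 2^-1 0).
Proof.
move=> c0 f0; apply: (@classified_rep OrbIV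
  (mx3 1 0 0 (- a / (2 * f)) 0 (- c / (2 * f)) 0 1 0)
  (- c^-1) (2 * e / c) 0 1 _ _ (2 * f / c) (- c)); sym3_field.
Qed.

Lemma classified_swap_indef a b c d e f :
  classified (sym3 a b c d e f) (sym3 0 0 0 0 2^-1 0) ->
  classified (sym3 c b a f e d) (sym3 0 0 0 0 2^-1 0).
Proof.
by apply: (@classified_congr (mx3 0 0 1 0 1 0 1 0 0) 1 _ _
    (sym3 a b c d e f) (sym3 0 0 0 0 2^-1 0) (-1)); sym3_field.
Qed.

(** The sign of [a] tells whether [a x^2 + y^2] splits into two real lines, two
    conjugate lines, or a double line. *)
Lemma classified_parabolic_indef a :
  classified (sym3 a 1 0 0 0 0) (sym3 0 0 0 0 2^-1 0).
Proof.
have [a0|a0|->] := ltgtP a 0.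
- have [s s0 ->] := neg_sqr a0.
  apply: (@classified_rep OrbII
    (mx3 0 (2 * s)^-1 (- (2 * s)^-1) 0 2^-1 2^-1 1 0 0)
    1 0 0 (2 * s) _ _ (2 * s) (2 * s)^-1); sym3_field.
- have [s s0 ->] := pos_sqr a0.
  apply: (@classified_rep OrbIIa (mx3 0 0 s^-1 0 1 0 1 0 0)
    1 0 0 s _ _ (- s) s^-1); sym3_field.
- apply: (@classified_rep OrbIII (mx3 1 0 0 0 1 0 0 0 1) 0 1 1 0 _ _ 1 (- 1)); sym3_field.
Qed.

(** When both coefficients are negative, [x] and [z] are rescaled so that they
    become [-1]; then [Y = x + z], [Z = x - z] give
    [y^2 - x^2 - z^2 = X^2 - (Y^2 + Z^2) / 2] and [x z = (Y^2 - Z^2) / 4]. Opposite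
    signs give Ib, two positive coefficients Ia. *)
Lemma classified_diag_indef a c :
  classified (sym3 a 1 c 0 0 0) (sym3 0 0 0 0 2^-1 0).
Proof.
have [a0|a0|->] := ltgtP a 0.
3: by apply: classified_swap_indef; apply: classified_parabolic_indef.
all: have [c0|c0|->] := ltgtP c 0; last exact: classified_parabolic_indef.
- have [[s s0 ->] [t t0 ->]] := (neg_sqr a0, neg_sqr c0).
  apply: (@classified_rep OrbI
    (mx3 0 (2 * s)^-1 (2 * s)^-1 1 0 0 0 (2 * t)^-1 (- (2 * t)^-1))
    1 (- (2 * s * t)) 1 (2 * s * t) _ _ (2 * s * t) (4 * s * t)^-1); sym3_field.
- have [[s s0 ->] [t t0 ->]] := (neg_sqr a0, pos_sqr c0).
  apply: (@classified_rep OrbIb (mx3 0 0 s^-1 0 1 0 t^-1 0 0)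
    1 0 0 (s * t) _ _ (- (s * t)) (s * t)^-1); sym3_field.
- have [[s s0 ->] [t t0 ->]] := (pos_sqr a0, neg_sqr c0).
  apply: (@classified_rep OrbIb (mx3 s^-1 0 0 0 1 0 0 0 t^-1)
    1 0 0 (s * t) _ _ (s * t) (s * t)^-1); sym3_field.
- have [[s s0 ->] [t t0 ->]] := (pos_sqr a0, pos_sqr c0).
  apply: (@classified_rep OrbIa (mx3 s^-1 0 0 0 1 0 0 0 t^-1)
    1 0 0 (s * t) _ _ (s * t) (s * t)^-1); sym3_field.
Qed.

(** The singular form is [x z]. As in the definite case, the other form either
    vanishes at the vertex [(0, 1, 0)] or can be made diagonal modulo [x z]. *)
Lemma classified_indef a b c d e f :
  \det (sym3 a b c d e f) != 0 ->
  classified (sym3 a b c d e f) (sym3 0 0 0 0 2^-1 0).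
Proof.
have [->|b0] := eqVneq b 0.
  have [->|d0] := eqVneq d 0.
    have [->|f0] := eqVneq f 0.
      by rewrite det_sym3 !(mulr0, mul0r, expr0n, subr0, addr0) eqxx.
    have [->|c0 _] := eqVneq c 0; last exact: classified_IV_indef.
    by rewrite det_sym3 !(mulr0, mul0r, expr0n, subr0, addr0) eqxx.
  have [->|f0 _] := eqVneq f 0; last exact: classified_II_indef.
  have [->|a0 _] := eqVneq a 0; last first.
    by apply: classified_swap_indef; apply: classified_IV_indef.
  by rewrite det_sym3 !(mulr0, mul0r, expr0n, subr0, addr0) eqxx.
apply: (@classified_congr_nondeg (mx3 1 0 0 (- f / b) 1 (- d / b) 0 0 1) 1 _ _
    (sym3 (a - f ^+ 2 / b) b (c - d ^+ 2 / b) 0 (e - d * f / b) 0)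
    (sym3 0 0 0 0 2^-1 0) 1); try sym3_field.
move: (a - _) (c - _) (e - _) => {}a {}c {d f} {}e _.
apply: (@classified_comb b^-1 (- (2 * e / b))); first by rewrite invr_eq0.
rewrite !scale_sym3 add_sym3.
have -> : sym3 (b^-1 * a + - (2 * e / b) * 0) (b^-1 * b + - (2 * e / b) * 0)
     (b^-1 * c + - (2 * e / b) * 0) (b^-1 * 0 + - (2 * e / b) * 0)
     (b^-1 * e + - (2 * e / b) / 2) (b^-1 * 0 + - (2 * e / b) * 0) =
  sym3 (a / b) 1 (c / b) 0 0 0 by sym3_field.
exact: classified_diag_indef.
Qed.

(** According to the sign of [m], the singular form [x^2 + m z^2] is a pair of
    conjugate lines, a double line, or a pair of real lines normalized to [x z]. *)
Lemma classified_diag_pencil a b c d e f m :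
  \det (sym3 a b c d e f) != 0 ->
  classified (sym3 a b c d e f) (sym3 1 0 m 0 0 0).
Proof.
have [m0|m0|->] := ltgtP m 0; last exact: classified_rank1.
- have [t t0 ->] := neg_sqr m0.
  apply: (@classified_congr_nondeg
    (mx3 2^-1 0 2^-1 0 1 0 (2 * t)^-1 0 (- (2 * t)^-1)) 1 _ _
    (sym3 (a / 4 + c / (4 * t ^+ 2) + e / (2 * t)) b
          (a / 4 + c / (4 * t ^+ 2) - e / (2 * t)) (f / 2 - d / (2 * t))
          (a / 4 - c / (4 * t ^+ 2)) (f / 2 + d / (2 * t)))
    (sym3 0 0 0 0 2^-1 0) (- (2 * t))); try sym3_field.
  exact: classified_indef.
- have [t t0 ->] := pos_sqr m0.
  apply: (@classified_congr_nondeg (mx3 1 0 0 0 1 0 0 0 t^-1) 1 _ _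
    (sym3 a b (c / t ^+ 2) (d / t) (e / t) f) (sym3 1 0 1 0 0 0) t); try sym3_field.
  exact: classified_def.
Qed.

(** A nonzero form killed by the vector [(0, 1, 0)] is a binary form in [x] and
    [z]; it is diagonalized, possibly after exchanging the variables. *)
Lemma classified_singular a b c d e f p r w :
  (p, r, w) != (0, 0, 0) -> \det (sym3 a b c d e f) != 0 ->
  classified (sym3 a b c d e f) (sym3 p 0 r 0 w 0).
Proof.
wlog p0 : a b c d e f p r w / p != 0 => [wlog_p|_].
  have [->|p0] := eqVneq p 0; last exact: wlog_p.
  have [->|r0 _] := eqVneq r 0; last first.
    apply: (@classified_congr_nondeg (mx3 0 0 1 0 1 0 1 0 0) 1 _ _
      (sym3 c b a f e d) (sym3 r 0 0 0 w 0) (-1)); try sym3_field.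
    by apply: wlog_p; rewrite // !xpair_eqE negb_and (negPf r0).
  have [->|w0 _ A0] := eqVneq w 0; first by rewrite eqxx.
  have w2 : (2 * w)^-1 != 0 by rewrite invr_eq0 mulf_neq0 ?pnatr_eq0.
  apply: (@classified_congr (mx3 1 0 0 0 1 0 0 0 1) (2 * w)^-1 _ _
    (sym3 a b c d e f) (sym3 0 0 0 0 2^-1 0) 1) (classified_indef A0) => //; sym3_field.
have [m wE] : exists m, r = p * m + w ^+ 2 / p.
  by exists ((r - w ^+ 2 / p) / p); field.
apply: (@classified_congr_nondeg (mx3 1 0 (- w / p) 0 1 0 0 0 1) p^-1 _ _
  (sym3 a b (c - 2 * e * w / p + a * w ^+ 2 / p ^+ 2) (d - f * w / p)
    (e - a * w / p) f) (sym3 1 0 m 0 0 0) 1); try sym3_field.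
- by rewrite invr_eq0.
- by rewrite wE; sym3_field.
- exact: classified_diag_pencil.
Qed.

Lemma sym_congr (P A : 'M[R]_3) : A^T = A -> (congr_mx P A)^T = congr_mx P A.
Proof. by move=> At; rewrite /congr_mx !trmx_mul trmxK At mulmxA. Qed.

(** The characteristic polynomial of [B A^-1] has odd degree, so the pencil has a
    real singular member [B - k A], which is nonzero. Its kernel is moved to the
    second coordinate vector. *)
Theorem classification A B : A^T = A -> B^T = B -> \det A != 0 ->
  (forall k, B != k *: A) -> classified A B.
Proof.
move=> At Bt A0 Bk.
have Au : A \in unitmx by rewrite unitmxE unitfE.
have [|k] := @odd_poly_root R (char_poly (B *m invmx A)).
  by rewrite size_char_poly.
rewrite -eigenvalue_root_char => /eigenvalueP[v vB v0].
pose C := B - k *: A.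
have Ct : C^T = C by rewrite /C linearB linearZ /= At Bt.
have vC : v *m C = 0.
  by rewrite /C mulmxBr -scalemxAr -[B](mulmxKV Au) mulmxA vB -scalemxAl subrr.
have [P Pu PE] : {P : 'M[R]_3 | P \in unitmx & row o2 P = v}.
  have [|P Pu PE] := @complete_unitmx R 1 3 (delta_mx 0 o2) (\matrix_(i < 3) v).
    by rewrite -rowE rowK mxrank_delta rank_rV v0.
  by exists P; rewrite // rowE -PE -rowE rowK.
pose A' := congr_mx P^T A; pose C' := congr_mx P^T C.
have C'2 i : C' o2 i = 0.
  have rC' : row o2 C' = 0 by rewrite /C' /congr_mx trmxK !row_mul PE vC mul0mx.
  by have /rowP/(_ i) := rC'; rewrite !mxE.
have C't : C'^T = C' by apply: sym_congr.
have C'E : C' = sym3 (C' o1 o1) 0 (C' o3 o3) 0 (C' o1 o3) 0.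
  have C'12 : C' o1 o2 = 0 by rewrite -C't mxE C'2.
  by rewrite {1}[C']sym_mx3E // !C'2 C'12.
have PTu : P^T \in unitmx by rewrite unitmx_tr.
have [o oAC] : classified A' C'.
  have A't : A'^T = A' by apply: sym_congr.
  rewrite C'E (sym_mx3E A't); apply: classified_singular.
    apply: contra_neq (Bk k) => -[e1 e3 e13].
    have C'0 : C' = 0.
      by rewrite C'E e1 e3 e13 [RHS]mx3E !mxE.
    have : C = congr_mx (invmx P^T) C'.
      by rewrite /C' congr_mxM mulmxV // /congr_mx trmx1 mul1mx mulmx1.
    rewrite C'0 /congr_mx mulmx0 mul0mx => /eqP; rewrite subr_eq0 => /eqP.
    exact: id.
  rewrite -sym_mx3E //.
  by rewrite /congr_mx !det_mulmx det_tr !mulf_neq0 // -unitfE -unitmxE.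
exists o.
apply: (mx_orbit_step (P := P^T) (a := 1) (b := 0) (c := - k) (d := 1)) oAC => //.
- by rewrite mulr1 mul0r subr0 oner_neq0.
- by rewrite scale1r scale0r addr0.
- by rewrite scale1r scaleNr addrC.
Qed.
End Classification.

(** * Discriminant and Hessian of a binary cubic form *)

Local Notation t := ('X_(0 : 'I_2)).
Local Notation u := ('X_(1 : 'I_2)).

Definition bincubic (F : nzRingType) (c3 c2 c1 c0 : F) : {mpoly F[2]} :=
  c3 *: t ^+ 3 + c2 *: (t ^+ 2 * u) + c1 *: (t * u ^+ 2) + c0 *: u ^+ 3.

Lemma dehomog_bincubic (F : fieldType) (c3 c2 c1 c0 : F) :
  dehomog (bincubic c3 c2 c1 c0) =
  c3%:P * 'X^3 + c2%:P * 'X^2 + c1%:P * 'X + c0%:P.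
Proof.
rewrite /dehomog /bincubic !mmapD !mmapZ !(rmorphXn, rmorphM) /= !mmapX !mmap1U /tnth /=.
by rewrite !(expr1n, mulr1).
Qed.

Lemma coef_bincubic (F : fieldType) (c3 c2 c1 c0 : F) :
  (bincubic c3 c2 c1 c0)@_(U_((0 : 'I_2)%R) *+ 3) = c3.
Proof.
rewrite /bincubic !mcoeffD !mcoeffZ !mpolyXn -!mpolyXD !mcoeffX.
have ne (m : 'X_{1..2}) : m 0 != 3%N -> (m == (U_((0 : 'I_2)%R) *+ 3)%MM) = false.
  by apply: contra_neqF => /eqP->; rewrite mulmnE mnm1E eqxx.
rewrite eqxx !ne; last by rewrite ?(mnmDE, mulmnE, mnm1E).
all: rewrite ?(mnmDE, mulmnE, mnm1E) //.
by rewrite mulr1 !mulr0 !addr0.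
Qed.

(** The usual discriminant of [a t^3 + b t^2 + c t + d]. *)
Definition cubic_disc (F : pzRingType) (a b c d : F) : F :=
  b ^+ 2 * c ^+ 2 - 4 * a * c ^+ 3 - 4 * b ^+ 3 * d + 18 * a * b * c * d
  - 27 * a ^+ 2 * d ^+ 2.

(** Determinants of matrices given by functions on natural numbers: expansion
    along the first row then stays within the same shape, and the entries of the
    minors reduce by computation. *)
Definition nat_det (F : comNzRingType) n (f : nat -> nat -> F) : F :=
  \det (\matrix_(i < n, j < n) f i j).

Lemma nat_detS (F : comNzRingType) n (f : nat -> nat -> F) :
  nat_det n.+1 f =
  \sum_(j < n.+1) f 0%N j * ((-1) ^+ j * nat_det n (fun i k => f i.+1 (bump j k))).
Proof.
rewrite /nat_det (expand_det_row _ ord0); apply: eq_bigr => j _.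
rewrite mxE /cofactor add0n; congr (_ * (_ * \det _)).
by apply/matrixP => i k; rewrite !mxE.
Qed.

Lemma nat_det3 (F : comNzRingType) (f : nat -> nat -> F) :
  nat_det 3 f =
  f 0 0 * (f 1 1 * f 2 2 - f 1 2 * f 2 1) - f 0 1 * (f 1 0 * f 2 2 - f 1 2 * f 2 0)
  + f 0 2 * (f 1 0 * f 2 1 - f 1 1 * f 2 0).
Proof. by rewrite /nat_det [X in \det X]mx3E detmx3 !mxE. Qed.

(** The sizes of [p] and [q] occur in the type of the Sylvester matrix; this form
    replaces them by known numbers. *)
Lemma resultantE (F : comNzRingType) (p q : {poly F}) m n :
  size q = m.+1 -> size p = n.+1 ->
  resultant p q = nat_det (m + n) (fun i j =>
    if (i < m)%N then p`_(j - i) *+ (i <= j)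
    else q`_(j - (i - m)) *+ (i - m <= j)).
Proof.
move=> sq sp; have [sq' sp'] : m = (size q).-1 /\ n = (size p).-1 by rewrite sq sp.
rewrite {sq sp}sq' sp' /resultant; congr (\det _); apply/matrixP=> i j.
rewrite Sylvester_mxE mxE; case: splitP => k -> //.
by rewrite addKn.
Qed.

Lemma resultant_cubic (F : numFieldType) (a b c d : F) : a != 0 ->
  let p := a%:P * 'X^3 + b%:P * 'X^2 + c%:P * 'X + d%:P in
  resultant p p^`() = - a * cubic_disc a b c d.
Proof.
move=> a0 p.
have pE : p = Poly [:: d; c; b; a].
  by rewrite /p /= !cons_poly_def mul0r add0r; ring.
have dpE : p^`() = Poly [:: c; 2 * b; 3 * a].
  apply/polyP => i; rewrite coef_deriv pE !coef_Poly.
  by case: i => [|[|[|[|i]]]]; rewrite /= ?nth_nil ?mul0rn ?mulr_natl ?mulr1n.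
have ps : p = [:: d; c; b; a] :> seq F by rewrite pE (@PolyK _ 0).
have dps : p^`() = [:: c; 2 * b; 3 * a] :> seq F.
  by rewrite dpE (@PolyK _ 0) //= mulf_neq0 ?pnatr_eq0.
rewrite (@resultantE _ _ _ 2 3) ?dps ?ps //.
rewrite nat_detS !big_ord_recr big_ord0 /= !nat_detS !big_ord_recr !big_ord0 /=.
rewrite !nat_det3 /= /bump /= /cubic_disc; ring.
Qed.

Lemma mderivXi (F : nzRingType) n (i j : 'I_n) :
  ('X_i : {mpoly F[n]})^`M(j) = (i == j)%:R.
Proof.
rewrite mderivX mnm1E; case: eqP => [->|_]; last by rewrite scale0r.
rewrite scale1r (_ : (U_(j) - U_(j))%MM = 0%MM) ?mpolyX0 //.
by apply/mnmP=> k; rewrite mnmBE mnm0E subnn.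
Qed.

Lemma mderiv_bincubic (F : comNzRingType) (c3 c2 c1 c0 : F) i :
  (bincubic c3 c2 c1 c0)^`M(i) = if i == 0 then
    (3 * c3) *: t ^+ 2 + (2 * c2) *: (t * u) + c1 *: u ^+ 2
  else c2 *: t ^+ 2 + (2 * c1) *: (t * u) + (3 * c0) *: u ^+ 2.
Proof.
rewrite /bincubic !exprS !expr0 !(mderivD, mderivZ, mderivM, mderivXi).
case: i => [[|[|//]] lti] /=; rewrite -?mpolyC1 ?mderivC -!mul_mpolyC; ring.
Qed.

Lemma mderiv_binquadratic (F : comNzRingType) (c2 c1 c0 : F) i :
  (c2 *: t ^+ 2 + c1 *: (t * u) + c0 *: u ^+ 2)^`M(i) = if i == 0 then
    (2 * c2) *: t + c1 *: u else c1 *: t + (2 * c0) *: u.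
Proof.
rewrite !exprS !expr0 !(mderivD, mderivZ, mderivM, mderivXi).
case: i => [[|[|//]] lti] /=; rewrite -?mpolyC1 ?mderivC -!mul_mpolyC; ring.
Qed.

Lemma hessian_bincubic (F : fieldType) (c3 c2 c1 c0 : F) :
  hessian (bincubic c3 c2 c1 c0) =
  (12 * c3 * c1 - 4 * c2 ^+ 2) *: t ^+ 2
  + (36 * c3 * c0 - 4 * c2 * c1) *: (t * u)
  + (12 * c2 * c0 - 4 * c1 ^+ 2) *: u ^+ 2.
Proof.
rewrite /hessian det2 !mxE !mderiv_bincubic /= !mderiv_binquadratic /=.
rewrite -!mul_mpolyC; ring.
Qed.

(** * The characteristic form on each orbit *)

Lemma char_formE (F : fieldType) (f g : {mpoly F[3]}) v :
  (char_form f g).@[v] = \det (v 0 *: qmx f + v 1 *: qmx g).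
Proof.
rewrite /char_form -det_map_mx; congr (\det _); apply/matrixP=> i j.
by rewrite !mxE rmorphD !rmorphM /= !mevalXU !mevalC.
Qed.

(** The coefficients of the binary cubic form [det (s M + r N)], for the
    representatives [M], [N] of the orbit. *)
Definition orbit_cubic (F : fieldType) (o : orbit_name) : F * F * F * F :=
  match o with
  | OrbI    => (0, 1, 1, 0)
  | OrbIa   => (1, 0, - 2^-1 ^+ 2, 0)
  | OrbIb   => (- 1, 0, - 2^-1 ^+ 2, 0)
  | OrbII | OrbIIa => (0, 0, - 2^-1 ^+ 2, 0)
  | OrbIII => (0, - 2^-1 ^+ 2, 0, 0)
  | OrbIIIa => (0, 1, 0, 0)
  | OrbIV | OrbV => (2^-1 ^+ 2, 0, 0, 0)
  end.

Lemma det_orbit_mx (F : numFieldType) (L : comNzRingType) (phi : {rmorphism F -> L}) o s r :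
  let: (p3, p2, p1, p0) := orbit_cubic F o in
  \det (s *: map_mx phi (orbit_mx F o).1 + r *: map_mx phi (orbit_mx F o).2) =
  phi p3 * s ^+ 3 + phi p2 * s ^+ 2 * r + phi p1 * s * r ^+ 2 + phi p0 * r ^+ 3.
Proof.
have half : (1 + 1) * phi 2^-1 = 1.
  by rewrite -(rmorph1 phi) -rmorphD -rmorphM; congr (phi _); field.
case: o; rewrite /= /sym3 !map_mx3 !scalemx3 !addmx3 detmx3
  ?(rmorphN, rmorphXn, rmorph0, rmorph1) /=.
all: try by ring.
(* For the orbit II the expansion is [- 2 (1 / 2)^3 s r^2]. *)
have -> : phi (2^-1) ^+ 2 = (1 + 1) * phi 2^-1 * phi 2^-1 ^+ 2 by rewrite half mul1r.
ring.
Qed.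

(** The form [p3 s^3 + p2 s^2 r + p1 s r^2 + p0 r^3] for [s = a t + c u] and
    [r = b t + d u]. *)
Definition subst_cubic (F : nzRingType) (p3 p2 p1 p0 a b c d : F) : {mpoly F[2]} :=
  bincubic
   (p3 * a ^+ 3 + p2 * a ^+ 2 * b + p1 * a * b ^+ 2 + p0 * b ^+ 3)
   (3 * p3 * a ^+ 2 * c + p2 * (a ^+ 2 * d + 2 * a * b * c)
    + p1 * (2 * a * b * d + b ^+ 2 * c) + 3 * p0 * b ^+ 2 * d)
   (3 * p3 * a * c ^+ 2 + p2 * (2 * a * c * d + b * c ^+ 2)
    + p1 * (a * d ^+ 2 + 2 * b * c * d) + 3 * p0 * b * d ^+ 2)
   (p3 * c ^+ 3 + p2 * c ^+ 2 * d + p1 * c * d ^+ 2 + p0 * d ^+ 3).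

(** A congruence by [P] multiplies the determinant by [det P ^ 2], and a change of
    generators is a linear substitution in [(t, u)]. *)
Lemma char_form_orbit (F : numFieldType) o (f g : {mpoly F[3]}) :
  mx_orbit o (qmx f) (qmx g) ->
  let: (p3, p2, p1, p0) := orbit_cubic F o in
  exists k a b c d, [/\ k != 0, a * d - b * c != 0 &
    char_form f g = k *: subst_cubic p3 p2 p1 p0 a b c d].
Proof.
have := @det_orbit_mx F _ (@mpolyC 2 F) o.
rewrite /mx_orbit; case: (orbit_cubic F o) => [[[p3 p2] p1] p0].
case: (orbit_mx F o) => M N detE [P [a [b [c [d [Pu D fE gE]]]]]].
exists ((\det P) ^+ 2), a, b, c, d; split=> //.
  by rewrite expf_eq0 /= -unitfE -unitmxE.
rewrite /char_form fE gE.
rewrite !map_congr_mx -congr_mx_lin !map_mxD !map_mxZ lincomb2 /congr_mx !det_mulmx det_tr.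
rewrite detE /= det_map_mx /subst_cubic /bincubic -!mul_mpolyC; ring.
Qed.

Lemma bincubicZ (F : comNzRingType) k (c3 c2 c1 c0 : F) :
  k *: bincubic c3 c2 c1 c0 = bincubic (k * c3) (k * c2) (k * c1) (k * c0).
Proof. by rewrite /bincubic !scalerDr !scalerA. Qed.

(** Evaluation at [t = 1], [u = 0]. *)
Lemma lead_char_form (F : fieldType) (f g : {mpoly F[3]}) c3 c2 c1 c0 :
  char_form f g = bincubic c3 c2 c1 c0 -> c3 = disc f.
Proof.
move=> PhiE; have := char_formE f g (fun i => (i == 0)%:R).
rewrite PhiE /bincubic !rmorphD /= !mevalZ !(rmorphXn, rmorphM) /= !mevalXU /=.
rewrite !(expr1n, expr0n, mulr0, mulr1, addr0, scale1r, scale0r) /= => ->.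
by rewrite /disc.
Qed.

Lemma disc_cubic_bincubic (F : numFieldType) (a b c d : F) : a != 0 ->
  disc_cubic (bincubic a b c d) = - (cubic_disc a b c d / 27).
Proof.
move=> a0; rewrite /disc_cubic dehomog_bincubic resultant_cubic //.
rewrite coef_bincubic; field.
by rewrite a0.
Qed.

Lemma cubic_disc_subst (F : comNzRingType) (k p3 p2 p1 p0 a b c d : F) :
  cubic_disc
   (k * (p3 * a ^+ 3 + p2 * a ^+ 2 * b + p1 * a * b ^+ 2 + p0 * b ^+ 3))
   (k * (3 * p3 * a ^+ 2 * c + p2 * (a ^+ 2 * d + 2 * a * b * c)
    + p1 * (2 * a * b * d + b ^+ 2 * c) + 3 * p0 * b ^+ 2 * d))
   (k * (3 * p3 * a * c ^+ 2 + p2 * (2 * a * c * d + b * c ^+ 2)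
    + p1 * (a * d ^+ 2 + 2 * b * c * d) + 3 * p0 * b * d ^+ 2))
   (k * (p3 * c ^+ 3 + p2 * c ^+ 2 * d + p1 * c * d ^+ 2 + p0 * d ^+ 3))
  = k ^+ 4 * (a * d - b * c) ^+ 6 * cubic_disc p3 p2 p1 p0.
Proof. rewrite /cubic_disc; ring. Qed.

Definition orbit_disc (F : fieldType) o : F :=
  let: (p3, p2, p1, p0) := orbit_cubic F o in cubic_disc p3 p2 p1 p0.

Lemma orbit_discE (F : numFieldType) o : orbit_disc F o =
  match o with OrbI => 1 | OrbIa => 16^-1 | OrbIb => - 16^-1 | _ => 0 end.
Proof. by case: o; rewrite /orbit_disc /cubic_disc /=; field. Qed.

(** The discriminant is multiplied by even powers of the factor [k] and of the
    determinant of the substitution; its sign is thus that of the representative,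
    reversed by the normalization of [disc_cubic]. *)
Lemma sgr_disc_cubic (R : realFieldType) o (f g : {mpoly R[3]}) :
  disc f != 0 -> mx_orbit o (qmx f) (qmx g) ->
  Num.sg (disc_cubic (char_form f g)) =
  match o with OrbI | OrbIa => -1 | OrbIb => 1 | _ => 0 end.
Proof.
move=> f0 /char_form_orbit; have := orbit_discE R o; rewrite /orbit_disc.
case: (orbit_cubic R o) => [[[p3 p2] p1] p0] discE [k [a [b [c [d [k0 D PhiE]]]]]].
rewrite /subst_cubic bincubicZ in PhiE; rewrite PhiE.
rewrite disc_cubic_bincubic ?(lead_char_form PhiE) // -(lead_char_form PhiE).
rewrite cubic_disc_subst discE sgrN !(sgrX, sgrV, sgrM).
rewrite -[4%N]/(2 * 2)%N -[6%N]/(2 * 3)%N !exprM !sqr_sg k0 D !expr1n !mul1r.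
rewrite (gtr0_sg (_ : 0 < 27)) ?ltr0n // mulr1.
by case: o {discE}; rewrite ?sgrN ?sgr0 ?sgr1 ?oppr0 ?gtr0_sg ?invr_gt0 ?opprK ?ltr0n.
Qed.

Lemma hessian_subst (F : fieldType) (k p3 p2 p1 p0 a b c d : F) :
  let s := a *: t + c *: u in let r := b *: t + d *: u in
  hessian (k *: subst_cubic p3 p2 p1 p0 a b c d) =
  (k * (a * d - b * c)) ^+ 2 *:
    ((12 * p3 * p1 - 4 * p2 ^+ 2) *: s ^+ 2
     + (36 * p3 * p0 - 4 * p2 * p1) *: (s * r)
     + (12 * p2 * p0 - 4 * p1 ^+ 2) *: r ^+ 2).
Proof.
rewrite /subst_cubic bincubicZ hessian_bincubic -!mul_mpolyC; ring.
Qed.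

(** The Hessian of [p2 s^2 r + p1 s r^2], when one of the terms is absent, is a
    nonzero multiple of the square of the linear form whose square divides the
    cubic; it is evaluated at [t = 1], [u = 0]. *)
Lemma hessian_subst_neq0 (F : numFieldType) (k p2 p1 a b c d : F) :
  k != 0 -> a * d - b * c != 0 ->
  p2 * p1 = 0 -> (p2 * a) ^+ 2 + (p1 * b) ^+ 2 != 0 ->
  hessian (k *: subst_cubic 0 p2 p1 0 a b c d) != 0.
Proof.
move=> k0 D p21 p0; rewrite hessian_subst.
apply/negP => /eqP/(congr1 (meval (fun i : 'I_2 => (i == 0)%:R))).
rewrite meval0 !(mevalZ, mevalD) !(rmorphXn, rmorphM) /= !(mevalD, mevalZ) !mevalXU /= => /eqP.
apply/negP; rewrite mulf_neq0 ?expf_neq0 ?mulf_neq0 //.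
rewrite (_ : _ + _ = - 4 * ((p2 * a) ^+ 2 + (p1 * b) ^+ 2) - 4 * (p2 * p1) * (a * b));
  last by ring.
by rewrite p21 mulr0 mul0r subr0 mulf_neq0 ?oppr_eq0 ?pnatr_eq0.
Qed.

(** A nonzero binary cubic form with a multiple root has vanishing Hessian exactly
    when it is a cube. The multiple linear factor does not vanish at [t = 1],
    [u = 0] because the leading coefficient is the discriminant of [f]. *)
Lemma hessian_eq0 (R : realFieldType) o (f g : {mpoly R[3]}) :
  disc f != 0 -> disc_cubic (char_form f g) = 0 ->
  mx_orbit o (qmx f) (qmx g) ->
  (hessian (char_form f g) == 0) =
  match o with OrbIV | OrbV => true | _ => false end.
Proof.
move=> f0 disc0 fg; have := sgr_disc_cubic f0 fg; rewrite disc0 sgr0.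
have q0 : - 2^-1 ^+ 2 != 0 :> R by rewrite oppr_eq0 expf_neq0 // invr_eq0 pnatr_eq0.
have := char_form_orbit fg; case: o {fg disc0} => /= -[k [a [b [c [d [k0 D PhiE]]]]]] //.
1-3: by move/eqP; rewrite eq_sym ?oppr_eq0 oner_eq0.
all: move=> _; have := PhiE; rewrite /subst_cubic bincubicZ => /lead_char_form lead.
all: rewrite PhiE; move: f0; rewrite -{}lead.
5,6: move=> _; rewrite hessian_subst.
5,6: by rewrite !(mulr0, mul0r, expr0n, subrr, scale0r, addr0, scaler0) eqxx.
all: rewrite !(mulr0, mul0r, add0r, addr0) => f0; apply/negbTE.
all: apply: hessian_subst_neq0 => //.
1,3,5,7: by rewrite ?mul0r ?mulr0.
all: rewrite mul0r expr0n ?addr0 ?add0r expf_neq0 // mulf_neq0 ?oner_eq0 //.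
all: by apply: contraNneq f0 => ->; rewrite ?expr0n ?(mulr0, mul0r).
Qed.

(** * The autopolar triangle on each orbit *)

Definition vec3 (A : Type) (a b c : A) : 'cV[A]_3 := \col_i tnth [tuple a; b; c] i.

Lemma vec3E (A : Type) (v : 'cV[A]_3) : v = vec3 (v o1 0) (v o2 0) (v o3 0).
Proof. by apply/colP; elim/ord3P; rewrite mxE. Qed.

Lemma mulmx3_vec (A : comPzRingType) (a b c d e f g h i x y z : A) :
  mx3 a b c d e f g h i *m vec3 x y z =
  vec3 (a * x + b * y + c * z) (d * x + e * y + f * z) (g * x + h * y + i * z).
Proof. by apply/colP; elim/ord3P; rewrite !mxE sum3 !mxE. Qed.

Definition cols3 (A : Type) (u v w : 'cV[A]_3) : 'M[A]_3 :=
  \matrix_(i, j) tnth [tuple u i 0; v i 0; w i 0] j.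

Lemma cols3_vec (A : Type) (a b c d e f g h i : A) :
  cols3 (vec3 a b c) (vec3 d e f) (vec3 g h i) = mx3 a d g b e h c f i.
Proof. by rewrite [LHS]mx3E !mxE. Qed.

Lemma mul_cols3 (A : comPzRingType) (M : 'M[A]_3) (u v w : 'cV[A]_3) :
  M *m cols3 u v w = cols3 (M *m u) (M *m v) (M *m w).
Proof.
apply/matrixP => i j; rewrite !mxE; elim/ord3P: j.
all: by rewrite /tnth /=; apply: eq_bigr => k _; rewrite mxE.
Qed.

Lemma det_cols3Z (A : comPzRingType) k (u v w : 'cV[A]_3) :
  \det (cols3 u v (k *: w)) = k * \det (cols3 u v w).
Proof.
rewrite [u]vec3E [v]vec3E [w]vec3E.
have -> : k *: vec3 (w o1 0) (w o2 0) (w o3 0) =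
  vec3 (k * w o1 0) (k * w o2 0) (k * w o3 0).
  by apply/colP; elim/ord3P; rewrite !mxE.
rewrite !cols3_vec !detmx3; ring.
Qed.

(** The value at [v] of the autopolar triangle of the pencil of [M] and [N], in a
    form whose covariance is apparent. If [M] is the identity and [N] is diagonal
    with entries [b1, b2, b3], the three columns are [v], [N v] and [N^2 v], and
    the value is the Vandermonde determinant of the [b_i] times [v1 v2 v3]. *)
Definition autopolar_at (A : comPzRingType) (M N : 'M[A]_3) (v : 'cV[A]_3) : A :=
  \det (cols3 (M *m v) (N *m v) (N *m cofmx M *m N *m v)).

(** Proved by expansion, because it is used over polynomial rings and for
    matrices that may be singular. *)
Lemma cofmx_mul (A : comPzRingType) (M N : 'M[A]_3) :
  cofmx (M *m N) = cofmx M *m cofmx N.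
Proof. rewrite [M]mx3E [N]mx3E !(mulmx3, cofmx3); congr mx3; ring. Qed.

Lemma mul_cofmx_tr (A : comPzRingType) n (M : 'M[A]_n) : M *m cofmx M^T = (\det M)%:M.
Proof.
by rewrite -mul_mx_adj; congr (_ *m _); apply/matrixP=> i j; rewrite !mxE cofactor_tr.
Qed.

(** In [congr_mx P N *m cofmx (congr_mx P M) *m congr_mx P N] the cofactor matrix
    of [P] meets [P^T], and that of [P^T] meets [P]; each product is [det P]. The
    third factor [det P] is the determinant of [P^T], common to the columns. *)
Lemma autopolar_at_congr (A : comPzRingType) (P M N : 'M[A]_3) v :
  autopolar_at (congr_mx P M) (congr_mx P N) v
  = (\det P) ^+ 3 * autopolar_at M N (P *m v).
Proof.
rewrite /autopolar_at.
have -> : congr_mx P N *m cofmx (congr_mx P M) *m congr_mx P N *m v =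
  P^T *m ((\det P) ^+ 2 *: (N *m cofmx M *m N *m (P *m v))).
  rewrite /congr_mx !cofmx_mul !mulmxA -[P^T *m N *m P *m cofmx _]mulmxA.
  rewrite mul_cofmx_tr.
  have -> : P^T *m N *m (\det P)%:M *m cofmx M *m cofmx P *m P^T *m N *m P *m v =
    P^T *m N *m (\det P)%:M *m cofmx M *m (cofmx P *m P^T) *m N *m P *m v.
    by rewrite !mulmxA.
  have -> : cofmx P *m P^T = (\det P)%:M.
    by rewrite -[LHS]trmxK trmx_mul trmxK
      (_ : (cofmx P)^T = cofmx P^T) ?mul_cofmx_tr ?tr_scalar_mx //;
      apply/matrixP=> i j; rewrite !mxE cofactor_tr.
  rewrite !mul_mx_scalar -!scalemxAl scalerA -expr2.
  by rewrite -scalemxAr !mulmxA.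
rewrite /congr_mx -!mulmxA -mul_cols3 det_mulmx det_tr det_cols3Z !mulmxA.
by rewrite mulrA -exprS.
Qed.

Lemma cofmx_map (A B : comPzRingType) (phi : {rmorphism A -> B}) n (M : 'M[A]_n) :
  cofmx (map_mx phi M) = map_mx phi (cofmx M).
Proof. by apply/matrixP => i j; rewrite !mxE cofactor_map_mx. Qed.

Lemma autopolar_at_map (A B : comPzRingType) (phi : {rmorphism A -> B}) M N v :
  autopolar_at (map_mx phi M) (map_mx phi N) (map_mx phi v) = phi (autopolar_at M N v).
Proof.
rewrite /autopolar_at -det_map_mx cofmx_map -!map_mxM; congr (\det _).
by apply/matrixP=> i; elim/ord3P; rewrite !mxE.
Qed.

(** Cofactors are quadratic in the entries, so the coefficient of [t] is the
    polarization of the cofactor matrix. *)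
Lemma OmegaE (F : fieldType) (f g : {mpoly F[3]}) :
  Omega f g = cofmx (qmx f + qmx g) - cofmx (qmx f) - cofmx (qmx g).
Proof.
rewrite /Omega -[- cofmx (qmx f)]scaleN1r -[- cofmx (qmx g)]scaleN1r.
rewrite [qmx f]mx3E [qmx g]mx3E !map_mx3 scalemx3 !addmx3 !cofmx3 map_mx3.
rewrite !scalemx3 !addmx3.
have cE (a b c d a' b' c' d' : F) :
  (('X * a%:P + a'%:P) * ('X * b%:P + b'%:P)
   - ('X * c%:P + c'%:P) * ('X * d%:P + d'%:P))`_1
  = (a + a') * (b + b') - (c + c') * (d + d') + -1 * (a * b - c * d)
    + -1 * (a' * b' - c' * d').
  have -> : ('X * a%:P + a'%:P) * ('X * b%:P + b'%:P)
   - ('X * c%:P + c'%:P) * ('X * d%:P + d'%:P) =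
   (a * b - c * d)%:P * 'X^2 + (a * b' + a' * b - c * d' - c' * d)%:P * 'X
   + (a' * b' - c' * d')%:P by ring.
  rewrite !coefD !coefCM coefXn coefX coefC /=; ring.
by rewrite /= !cE.
Qed.

Definition upper_entries (A : Type) (S : 'M[A]_3) (c : 'I_6) : A :=
  tnth [tuple S o1 o1; S o2 o2; S o3 o3; S o2 o3; S o1 o3; S o1 o2] c.

Lemma autopolar_mxE (F : fieldType) (f g : {mpoly F[3]}) r c :
  autopolar_mx f g r c =
  upper_entries (tnth [tuple cofmx (qmx f); Omega f g; cofmx (qmx g)] r) c.
Proof.
by rewrite mxE; case: c => [[|[|[|[|[|[|//]]]]]] ltc].
Qed.

Definition minor (A : comPzRingType) (S1 S2 S3 : 'M[A]_3) (i j k : 'I_6) : A :=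
  \det (mx3 (upper_entries S1 i) (upper_entries S1 j) (upper_entries S1 k)
            (upper_entries S2 i) (upper_entries S2 j) (upper_entries S2 k)
            (upper_entries S3 i) (upper_entries S3 j) (upper_entries S3 k)).

Lemma upper_entries_map (A B : Type) (phi : A -> B) (S : 'M[A]_3) c :
  upper_entries (map_mx phi S) c = phi (upper_entries S c).
Proof. by rewrite /upper_entries; case: c => [[|[|[|[|[|[|//]]]]]] ltc]; rewrite /tnth /= mxE. Qed.

Lemma minor_map (A B : comPzRingType) (phi : {rmorphism A -> B}) (S1 S2 S3 : 'M[A]_3) i j k :
  minor (map_mx phi S1) (map_mx phi S2) (map_mx phi S3) i j k =
  phi (minor S1 S2 S3 i j k).
Proof. by rewrite /minor !upper_entries_map -det_map_mx map_mx3. Qed.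

Lemma minor_autopolar_mx (F : fieldType) (f g : {mpoly F[3]}) i j k :
  \det (colsub (tnth [tuple i; j; k]) (autopolar_mx f g)) =
  minor (cofmx (qmx f)) (Omega f g) (cofmx (qmx g)) i j k.
Proof.
rewrite /minor; congr (\det _); rewrite [LHS]mx3E.
by congr mx3; rewrite mxE autopolar_mxE.
Qed.

Local Notation c1 := (@Ordinal 6 0 isT).
Local Notation c2 := (@Ordinal 6 1 isT).
Local Notation c3 := (@Ordinal 6 2 isT).
Local Notation b1 := (@Ordinal 6 3 isT).
Local Notation b2 := (@Ordinal 6 4 isT).
Local Notation b3 := (@Ordinal 6 5 isT).

(** Both sides are forms of degree 3 in [M], in [N] and in [(x, y, z)]. The
    cofactor matrix of [M + N] is expanded beforehand to keep the identity of
    polynomials in 15 variables small. *)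
Lemma autopolar_at_minors (A : comPzRingType) (a b c d e f a' b' c' d' e' f' x y z : A) :
  let M := sym3 a b c d e f in let N := sym3 a' b' c' d' e' f' in
  let m := minor (cofmx M) (cofmx (M + N) - cofmx M - cofmx N) (cofmx N) in
  autopolar_at M N (vec3 x y z) =
  - m b1 c2 c3 * x ^+ 3
  - m c1 b2 c3 * y ^+ 3
  - m c1 c2 b3 * z ^+ 3
  + (m c1 b1 c3 + 2 * m b3 b2 c3) * (x * y ^+ 2)
  + (m c1 c2 b1 + 2 * m b2 c2 b3) * (x * z ^+ 2)
  + (m b2 c2 c3 + 2 * m b1 b3 c3) * (y * x ^+ 2)
  + (m c1 c2 b2 + 2 * m c1 b1 b3) * (y * z ^+ 2)
  + (m b3 c2 c3 + 2 * m b1 c2 b2) * (z * x ^+ 2)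
  + (m c1 b3 c3 + 2 * m c1 b2 b1) * (z * y ^+ 2)
  + (- m c1 c2 c3 + 4 * m b1 b2 b3) * (x * y * z).
Proof.
move=> M N m; pose h (u v u' v' : A) := u * v' + u' * v.
have polE : cofmx (M + N) - cofmx M - cofmx N =
  sym3 (h b c b' c' - 2 * d * d') (h a c a' c' - 2 * e * e') (h a b a' b' - 2 * f * f')
    (h e f e' f' - h a d a' d') (h d f d' f' - h b e b' e') (h d e d' e' - h c f c' f').
  rewrite /M /N add_sym3 !cofmx3 -2!scaleN1r !scalemx3 !addmx3 /h.
  by congr mx3; ring.
have upE (S : 'M[A]_3) : ((upper_entries S c1 = S o1 o1) * (upper_entries S c2 = S o2 o2)
   * (upper_entries S c3 = S o3 o3) * (upper_entries S b1 = S o2 o3)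
   * (upper_entries S b2 = S o1 o3) * (upper_entries S b3 = S o1 o2))%type by [].
have entE (p1 q1 r1 p2 q2 r2 p3 q3 r3 : A) (S := mx3 p1 q1 r1 p2 q2 r2 p3 q3 r3) :
  ((S o1 o1 = p1) * (S o2 o2 = q2) * (S o3 o3 = r3) * (S o2 o3 = r2)
  * (S o1 o3 = r1) * (S o1 o2 = q1))%type by rewrite /S !mxE.
rewrite /m polE /autopolar_at /M /N !cofmx3 !mulmx3 !mulmx3_vec cols3_vec.
rewrite /minor !upE !entE !detmx3 /h.
ring.
Qed.

Lemma autopolarE (F : fieldType) (f g : {mpoly F[3]}) :
  autopolar f g = autopolar_at (map_mx (@mpolyC 3 F) (qmx f))
    (map_mx (@mpolyC 3 F) (qmx g)) (vec3 x y z).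
Proof.
rewrite /autopolar !minor_autopolar_mx OmegaE.
set m := minor _ _ _.
have mapE i j k : (m i j k)%:MP =
  let M := map_mx (@mpolyC 3 F) (qmx f) in
  let N := map_mx (@mpolyC 3 F) (qmx g) in
  minor (cofmx M) (cofmx (M + N) - cofmx M - cofmx N) (cofmx N) i j k.
  by rewrite /m -minor_map !map_mxB -!cofmx_map map_mxD.
move: m mapE; rewrite (sym_mx3E (tr_qmx f)) (sym_mx3E (tr_qmx g)) /sym3 !map_mx3 => m mapE.
rewrite autopolar_at_minors -!mapE -!mul_mpolyC; ring.
Qed.

Lemma meval_autopolar_at (F : fieldType) (M N P : 'M[F]_3) (w : 'cV[F]_3) :
  (autopolar_at (map_mx (@mpolyC 3 F) M) (map_mx (@mpolyC 3 F) N)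
    (map_mx (@mpolyC 3 F) P *m vec3 x y z)).@[fun i => w i 0] =
  autopolar_at M N (P *m w).
Proof.
have evalK m n (X : 'M[F]_(m, n)) :
    map_mx (meval (fun i => w i 0)) (map_mx (@mpolyC 3 F) X) = X.
  by apply/matrixP=> i j; rewrite !mxE /= mevalC.
rewrite -autopolar_at_map map_mxM !evalK; congr (autopolar_at _ _ (_ *m _)).
by rewrite [RHS]vec3E; apply/colP; elim/ord3P; rewrite !mxE /= mevalXU.
Qed.

(** Together with [autopolar_at_congr], this leaves only the representatives of
    the orbits to be examined. *)
Lemma autopolar_at_combinant (A : comPzRingType)
    (m1 m2 m3 m4 m5 m6 n1 n2 n3 n4 n5 n6 a b c d : A) (v : 'cV[A]_3) :
  let M := sym3 m1 m2 m3 m4 m5 m6 in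
  let N := sym3 n1 n2 n3 n4 n5 n6 in
  autopolar_at (a *: M + b *: N) (c *: M + d *: N) v =
  (a * d - b * c) ^+ 3 * autopolar_at M N v.
Proof.
rewrite /autopolar_at [v]vec3E.
rewrite !(scale_sym3, add_sym3, cofmx3, mulmx3, mulmx3_vec, cols3_vec) !detmx3.
ring.
Qed.

(** For [N = w w^T] both [N v] and [N (cofmx M) N v] are multiples of [w]. *)
Lemma autopolar_at_rank1 (A : comPzRingType) (m1 m2 m3 m4 m5 m6 w1 w2 w3 : A) v :
  autopolar_at (sym3 m1 m2 m3 m4 m5 m6)
    (sym3 (w1 ^+ 2) (w2 ^+ 2) (w3 ^+ 2) (w2 * w3) (w1 * w3) (w1 * w2)) v = 0.
Proof.
rewrite /autopolar_at [v]vec3E !(cofmx3, mulmx3, mulmx3_vec, cols3_vec) detmx3; ring.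
Qed.

Lemma orbit_mx_sym3 (F : fieldType) o :
  exists m1 m2 m3 m4 m5 m6 n1 n2 n3 n4 n5 n6,
   orbit_mx F o = (sym3 m1 m2 m3 m4 m5 m6, sym3 n1 n2 n3 n4 n5 n6).
Proof. by case: o; do 12!eexists. Qed.

Lemma autopolar_orbit (F : fieldType) o (f g : {mpoly F[3]}) :
  mx_orbit o (qmx f) (qmx g) ->
  exists (P : 'M[F]_3) k, [/\ P \in unitmx, k != 0 &
    autopolar f g = k%:MP *
     autopolar_at (map_mx (@mpolyC 3 F) (orbit_mx F o).1)
       (map_mx (@mpolyC 3 F) (orbit_mx F o).2)
       (map_mx (@mpolyC 3 F) P *m vec3 'X_o1 'X_o2 'X_o3)].
Proof.
rewrite /mx_orbit.
have [m1 [m2 [m3 [m4 [m5 [m6 [n1 [n2 [n3 [n4 [n5 [n6 ->]]]]]]]]]]]] := orbit_mx_sym3 F o.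
move=> [P [a [b [c [d [Pu D fE gE]]]]]].
exists P, ((\det P) ^+ 3 * (a * d - b * c) ^+ 3); split=> //.
  by rewrite mulf_neq0 ?expf_neq0 // -unitfE -unitmxE.
rewrite autopolarE fE gE !map_congr_mx autopolar_at_congr !map_mxD !map_mxZ /sym3 !map_mx3.
rewrite -!/(sym3 _ _ _ _ _ _) autopolar_at_combinant det_map_mx !(rmorphXn, rmorphM, rmorphB) /=.
by rewrite mulrA.
Qed.

(** A point off the triangle of the representatives, whenever that triangle is not
    identically zero. *)
Definition orbit_point (F : fieldType) (o : orbit_name) : 'cV[F]_3 :=
  match o with
  | OrbI => vec3 1 1 1
  | OrbIa | OrbIb => vec3 1 1 0
  | OrbIIa => vec3 0 1 1
  | OrbII => vec3 0 1 0
  | _ => vec3 1 0 0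
  end.

(** The three exceptional orbits are those whose pencils contain a double line,
    which is the second generator of the representative. *)
Lemma autopolar_eq0 (F : numFieldType) o (f g : {mpoly F[3]}) :
  mx_orbit o (qmx f) (qmx g) ->
  (autopolar f g == 0) =
  match o with OrbIII | OrbIIIa | OrbV => true | _ => false end.
Proof.
move=> /autopolar_orbit[P [k [Pu k0 GE]]].
have rank1E (w1 w2 w3 : F) M v : (orbit_mx F o).2 =
     sym3 (w1 ^+ 2) (w2 ^+ 2) (w3 ^+ 2) (w2 * w3) (w1 * w3) (w1 * w2) ->
   (orbit_mx F o).1 = M -> autopolar_at (map_mx (@mpolyC 3 F) M)
     (map_mx (@mpolyC 3 F) (orbit_mx F o).2) v = 0.
  have [m1 [m2 [m3 [m4 [m5 [m6 [? [? [? [? [? [? ->]]]]]]]]]]]] := orbit_mx_sym3 F o.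
  move=> /= -> <-; rewrite /sym3 !map_mx3 !(rmorphXn, rmorphM) /=.
  exact: autopolar_at_rank1.
have pointE : autopolar_at (orbit_mx F o).1 (orbit_mx F o).2 (orbit_point F o) =
   match o with
   | OrbI => -1 | OrbIa | OrbIb => 8^-1 | OrbIIa => - 8^-1
   | OrbII => - 64^-1 | OrbIV => 64^-1 | _ => 0 end.
  by case: o {GE rank1E}; rewrite /= /autopolar_at
    !(cofmx3, mulmx3, mulmx3_vec, cols3_vec) detmx3; field.
have [o3|o3] := boolP (match o with OrbIII | OrbIIIa | OrbV => true | _ => false end).
  apply/eqP; rewrite GE.
  have : exists w1 w2 w3 : F, (orbit_mx F o).2 =
     sym3 (w1 ^+ 2) (w2 ^+ 2) (w3 ^+ 2) (w2 * w3) (w1 * w3) (w1 * w2).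
    case: o o3 {GE rank1E pointE} => // _;
    [exists 0, 1, 0|exists 0, 0, 1|exists 1, 0, 0];
      by rewrite !(expr0n, expr1n, mulr0, mul0r, mulr1).
  by move=> [w1 [w2 [w3 NE]]]; rewrite (rank1E w1 w2 w3) ?mulr0.
apply/negbTE/eqP => G0.
have := congr1 (meval (fun i => (invmx P *m orbit_point F o) i 0)) GE.
rewrite G0 meval0 mevalM mevalC meval_autopolar_at mulKVmx // pointE => /esym/eqP.
apply/negP; rewrite mulf_neq0 //.
by case: o o3 {GE rank1E pointE}; rewrite ?oppr_eq0 ?invr_eq0 ?pnatr_eq0 ?oner_eq0.
Qed.

(** * The orbit of a pencil from its invariants *)

Unset Implicit Arguments.

Theorem proposition3 (R : realType) (f g : {mpoly R[3]})
    (f_quad : f \is 2.-homog) (g_quad : g \is 2.-homog)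
    (f_nondeg : disc f != 0) (g_nondeg : disc g != 0)
    (fg_nonprop : ~ proportional f g) :
  let Phi := char_form f g in
  let H := hessian Phi in
  let G := autopolar f g in
  let orbit o := pencil_in_orbit o (pencil f g) in
  [/\ disc_cubic Phi < 0 -> orbit OrbI \/ orbit OrbIa,
      disc_cubic Phi > 0 -> orbit OrbIb
    & disc_cubic Phi = 0 ->
      [\/ orbit OrbII \/ orbit OrbIIa,
          orbit OrbIII \/ orbit OrbIIIa,
          orbit OrbIV | orbit OrbV] /\
      [/\ H != 0 -> G != 0 -> orbit OrbII \/ orbit OrbIIa,
          H = 0 -> G != 0 -> orbit OrbIV,
          H != 0 -> G = 0 -> orbit OrbIII \/ orbit OrbIIIa
        & H = 0 -> G = 0 -> orbit OrbV]].
Proof.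
move=> Phi H G orbit.
have [k|o fg_o] := classification (tr_qmx f) (tr_qmx g) f_nondeg.
  apply/eqP => gE; apply: fg_nonprop; exists k, 1; split.
    by case=> _ /eqP; rewrite oner_eq0.
  by rewrite scale1r -(qform_qmx f_quad) -(qform_qmx g_quad) gE qformZ.
have orbit_o : orbit o by exact: pencil_in_orbit_mx.
have sgPhi : Num.sg (disc_cubic Phi) = _ := sgr_disc_cubic f_nondeg fg_o.
have H0 : disc_cubic Phi = 0 -> (H == 0) = _ :=
  fun Phi0 => hessian_eq0 f_nondeg Phi0 fg_o.
have G0 : (G == 0) = _ := autopolar_eq0 fg_o.
have oneN1 : (1 == -1 :> R) = false by rewrite gt_eqF // (lt_trans (ltrN10 _) ltr01).
split=> Phi0.
- move/eqP: sgPhi; rewrite ltr0_sg //.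
  by case: o orbit_o {fg_o H0 G0} => orbit_o;
    rewrite ?oppr_eq0 ?oner_eq0 1?eq_sym ?oneN1 //; [left|right].
- move/eqP: sgPhi; rewrite gtr0_sg //.
  by case: o orbit_o {fg_o H0 G0} => orbit_o; rewrite ?oner_eq0 ?oneN1.
move/eqP: sgPhi; rewrite Phi0 sgr0 eq_sym; move: {H0}(H0 Phi0) G0.
by case: o orbit_o {fg_o} => orbit_o /= HE GE; rewrite ?oppr_eq0 ?oner_eq0 // => _;
  (split; first by [apply: Or41; left | apply: Or41; right | apply: Or42; left
    | apply: Or42; right | apply: Or43 | apply: Or44]);
  split=> [H1 G1|H1 G1|H1 G1|H1 G1]; move: HE GE;
  rewrite -/H -/G ?H1 ?G1 ?eqxx ?(negbTE H1) ?(negbTE G1); auto.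
Qed.
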